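(* Let $I=(n_1,\dots,n_l)$ be a composition of $n$. (1) $\mathcal{P}^{U_I}=\mathbb{F}_q[x_1,\dots,x_{n_1},v_{2,1},\dots,v_{2,n_2},\dots,v_{l,1},\dots,v_{l,n_l}]$. (2) $\mathcal{A}^{U_I}$ is a free $\mathcal{P}^{U_I}$-module of rank $2^n$ with basis $\{N_{\tau(S),S}\mid S\in\mathbb{B}(n)\}$. In other words, $\mathcal{A}^{U_I}=\bigoplus_{S\in\mathbb{B}(n)}N_{\tau(S),S}\,\mathcal{P}^{U_I}$.
   Context: Let $p$ be a prime, $q=p^r$ with $r\ge1$, $I=(n_1,\dots,n_l)$ a composition of $n$, $m_0=0$, $m_k=n_1+\cdots+n_k$. $\mathcal{P}=\mathbb{F}_q[x_1,\dots,x_n]=S^\bullet(V)$ with $V=\mathbb{F}_q^n$, and $\mathcal{A}=\mathcal{P}\otimes E[y_1,\dots,y_n]$ with $E[y_1,\dots,y_n]=\wedge^\bullet(V)$ the exterior algebra. $g=(g_{ij})\in\mathrm{GL}_n(q)$ acts by algebra automorphisms with $gx_j=\sum_i g_{ij}x_i$, $gy_j=\sum_i g_{ij}y_i$. $U_I$ is the group of block upper triangular matrices (block sizes $n_1,\dots,n_l$) with identity diagonal blocks and arbitrary blocks above the diagonal. For $1\le i\le l$, $1\le j\le n_i$: $v_{i,j}=\prod_{\lambda_1,\dots,\lambda_{m_{i-1}}\in\mathbb{F}_q}(\lambda_1x_1+\cdots+\lambda_{m_{i-1}}x_{m_{i-1}}+x_{m_{i-1}+j})$. $\mathbb{B}(n)$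 is the set of all strictly increasing sequences (including the empty one) of elements of $\{1,\dots,n\}$. For $1\le s\le n$, $\tau(s)=m_j$ if $m_j<s\le m_{j+1}$; for $S\in\mathbb{B}(n)$ nonempty with largest entry $s$, $\tau(S)=\tau(s)$; $\tau(\emptyset)=0$. For $0\le b\le n$ and $S=(s_1,\dots,s_k,a_1,\dots,a_t)\in\mathbb{B}(n)$ nonempty with $s_k\le b<a_1$, $N_{b,S}\in\mathcal{A}$ is $\frac{1}{(k+t)!}$ times the row determinant $\sum_\sigma \mathrm{sgn}(\sigma)a_{1\sigma(1)}a_{2\sigma(2)}\cdots$ of the $(b+t)\times(b+t)$ matrix with columns indexed by $c=1,\dots,b,a_1,\dots,a_t$ (in this order), whose first $k+t$ rows are all $(y_c)_c$ and whose remaining $b-k$ rows are $(x_c^{q^e})_c$ with $e$ running increasingly through $\{0,1,\dots,b-1\}\setminus\{s_1-1,\dots,s_k-1\}$. The division by $(k+t)!$ is carried out over $\mathbb{Z}$ before reducing mod $p$; equivalently, $N_{b,S}$ is the sum of $\mathrm{sgn}(\sigma)a_{1\sigma(1)}a_{2\sigma(2)}\cdots a_{b+t,\sigma(b+t)}$ over permutations $\sigma$ with $\sigma(1)<\cdots<\sigma(k+t)$. In particular $N_{0,S}$ is the product of the $y_s$, $s\in S$, in increasing order. Also $N_{b,\emptyset}=1$. *)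

(* Defs.v *)
From HB Require Import structures.
From mathcomp Require Import all_boot all_order all_algebra all_fingroup.
From mathcomp Require Import ring.
From mathcomp.multinomials Require Import mpoly.

Set Implicit Arguments.
Unset Strict Implicit.
Unset Printing Implicit Defensive.

Import GRing.Theory.
Local Open Scope ring_scope.

(* The exterior algebra over R on generators y_0, ..., y_(n-1): the free      *)
(* R-module on the products y_S of the y_s, s \in S, in increasing order.     *)
(* For R = {mpoly F[n]} this is the tensor product over F of {mpoly F[n]}     *)
(* with the exterior algebra of F^n.                                          *)
Definition extalg (R : comNzRingType) (n : nat) := {ffun {set 'I_n} -> R}.

Section ExteriorAlgebra.
Variables (R : comNzRingType) (n : nat).
Local Notation A := (extalg R n).
Implicit Types (S T U : {set 'I_n}) (a b c : A).

HB.instance Definition _ := GRing.Lmodule.copy A {ffun {set 'I_n} -> R^o}.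

Definition ext_inv S T : nat := #|[set st in setX S T | (st.2 < st.1)%N]|.

(* y_S y_T = (-1) ^+ ext_inv S T y_(S :|: T) if S and T are disjoint, else 0 *)
Definition ext_mul a b : A := [ffun U : {set 'I_n} =>
  \sum_(S : {set 'I_n} | S \subset U)
     (-1) ^+ ext_inv S (U :\: S) * a S * b (U :\: S)].

Definition ext_one : A := [ffun U : {set 'I_n} => (U == set0)%:R].

Lemma ext_inv0l T : ext_inv set0 T = 0%N.
Proof.
by apply/eqP; rewrite cards_eq0; apply/eqP/setP => -[s t]; rewrite !inE.
Qed.

Lemma ext_inv0r S : ext_inv S set0 = 0%N.
Proof.
by apply/eqP; rewrite cards_eq0; apply/eqP/setP => -[s t]; rewrite !inE andbF.
Qed.

Lemma ext_invUl S T U : [disjoint S & T] ->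
  ext_inv (S :|: T) U = (ext_inv S U + ext_inv T U)%N.
Proof.
move=> dST; rewrite /ext_inv -cardsUI.
set B := _ :&: _; have -> : B = set0.
  apply/setP => -[s t]; rewrite !inE /=; case: (boolP (s \in S)) => //= sS.
  by rewrite (disjointFr dST sS) andbF.
rewrite cards0 addn0; apply: eq_card => -[s t].
by rewrite !inE /= !andb_orl.
Qed.

Lemma ext_invUr S T U : [disjoint T & U] ->
  ext_inv S (T :|: U) = (ext_inv S T + ext_inv S U)%N.
Proof.
move=> dTU; rewrite /ext_inv -cardsUI.
set B := _ :&: _; have -> : B = set0.
  apply/setP => -[s t]; rewrite !inE /=; case: (boolP (t \in T)) => tT.
    by rewrite (disjointFr dTU tT) !andbF.
  by rewrite andbF.
rewrite cards0 addn0; apply: eq_card => -[s t].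
by rewrite !inE /= andb_orr andb_orl.
Qed.

Lemma ext_mulA : associative ext_mul.
Proof.
move=> a b c; apply/ffunP => U; rewrite !ffunE; apply/esym.
transitivity (\sum_(S : {set 'I_n} | S \subset U) \sum_(S1 : {set 'I_n} | S1 \subset S)
   (-1) ^+ (ext_inv S (U :\: S) + ext_inv S1 (S :\: S1)) *
   (a S1 * b (S :\: S1) * c (U :\: S))).
  apply: eq_bigr => S _; rewrite ffunE -mulrA mulr_suml mulr_sumr.
  by apply: eq_bigr => S1 _; rewrite exprD -!mulrA.
rewrite (exchange_big_dep (fun S1 => S1 \subset U)) /=; last first.
  by move=> S S1 SU S1S; apply: subset_trans SU.
apply: eq_bigr => S1 S1U; rewrite ffunE mulr_sumr.
rewrite (reindex_onto (fun T => S1 :|: T) (fun S => S :\: S1)) /=; last first.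
  move=> S /andP[_ S1S]; apply/setP => x; rewrite !inE.
  by case: (boolP (x \in S1)) => //= /(subsetP S1S) ->.
apply: eq_big => [T|T /andP[/andP[S1TU _] /eqP TS1]].
  rewrite subUset S1U subsetUl /= andbT subsetD; congr (_ && _).
  by rewrite setDUl setDv set0U; apply/eqP/setDidPl.
have dS1T : [disjoint S1 & T].
  rewrite -TS1 disjoint_sym disjoints_subset; apply/subsetP => x.
  by rewrite !inE => /andP[].
rewrite TS1 setDDl; set W := U :\: (S1 :|: T).
have -> : U :\: S1 = T :|: W.
  apply/setP => x; rewrite !inE; case: (boolP (x \in S1)) => /= xS1.
    by rewrite (disjointFr dS1T xS1).
  by case: (boolP (x \in T)) => //= xT; rewrite (subsetP S1TU) // inE xT orbT.
have dTW : [disjoint T & W].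
  by apply/pred0P => x; rewrite !inE /=; case: (x \in T); rewrite ?orbT.
rewrite ext_invUl // ext_invUr // mulrACA mulrA.
rewrite !exprD; ring.
Qed.

Lemma ext_mul1l : left_id ext_one ext_mul.
Proof.
move=> a; apply/ffunP => U; rewrite ffunE (bigD1 set0) ?sub0set //= big1.
  by rewrite ext_inv0l setD0 ffunE eqxx !mul1r addr0.
by move=> S /andP[_ /negPf S0]; rewrite ffunE S0 mulr0 mul0r.
Qed.

Lemma ext_mul1r : right_id ext_one ext_mul.
Proof.
move=> a; apply/ffunP => U; rewrite ffunE (bigD1 U) //= big1.
  by rewrite setDv ext_inv0r ffunE eqxx mulr1 mul1r addr0.
move=> S /andP[SU SNU]; rewrite ffunE setD_eq0.
suff /negPf-> : ~~ (U \subset S) by rewrite mulr0.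
by apply: contra SNU => US; rewrite eqEsubset SU.
Qed.

Lemma ext_mulDl : left_distributive ext_mul +%R.
Proof.
move=> a b c; apply/ffunP => U; rewrite !ffunE -big_split /=.
by apply: eq_bigr => S _; rewrite ffunE mulrDr mulrDl.
Qed.

Lemma ext_mulDr : right_distributive ext_mul +%R.
Proof.
move=> a b c; apply/ffunP => U; rewrite !ffunE -big_split /=.
by apply: eq_bigr => S _; rewrite ffunE mulrDr.
Qed.

Lemma ext_one_neq0 : ext_one != 0.
Proof.
by apply/eqP => /ffunP/(_ set0)/eqP; rewrite !ffunE eqxx oner_eq0.
Qed.

HB.instance Definition _ := GRing.Zmodule_isNzRing.Build A
  ext_mulA ext_mul1l ext_mul1r ext_mulDl ext_mulDr ext_one_neq0.

Lemma ext_scaleAl (k : R) a b : k *: (a * b) = (k *: a) * b.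
Proof.
apply/ffunP => U; rewrite !ffunE scaler_sumr; apply: eq_bigr => S _.
by rewrite ffunE /GRing.scale /=; ring.
Qed.

HB.instance Definition _ := GRing.Lmodule_isLalgebra.Build R A ext_scaleAl.

Lemma ext_scaleAr (k : R) a b : k *: (a * b) = a * (k *: b).
Proof.
apply/ffunP => U; rewrite !ffunE scaler_sumr; apply: eq_bigr => S _.
by rewrite ffunE /GRing.scale /=; ring.
Qed.

HB.instance Definition _ := GRing.Lalgebra_isAlgebra.Build R A ext_scaleAr.

Definition ybas S : A := [ffun T : {set 'I_n} => (T == S)%:R].

Lemma ybasE S T : ybas S T = (T == S)%:R.
Proof. exact: ffunE. Qed.

Definition ygen (i : 'I_n) : A := ybas [set i].

Lemma ext_basisE a : a = \sum_(S : {set 'I_n}) a S *: ybas S.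
Proof.
apply/ffunP => U; rewrite sum_ffunE (bigD1 U) //= big1 => [|S SU].
  by rewrite !ffunE eqxx addr0 /GRing.scale /= mulr1.
by rewrite !ffunE eq_sym (negPf SU) /GRing.scale /= mulr0.
Qed.

Lemma ybasM S T : ybas S * ybas T =
  if [disjoint S & T] then (-1) ^+ ext_inv S T *: ybas (S :|: T) else 0.
Proof.
apply/ffunP => U; rewrite [LHS]ffunE.
have -> : (if [disjoint S & T] then (-1) ^+ ext_inv S T *: ybas (S :|: T)
           else 0) U
        = if [disjoint S & T] && (U == S :|: T) then (-1) ^+ ext_inv S T else 0.
  case: ifP => _; rewrite !ffunE //= /GRing.scale /=.
  by case: eqP; rewrite ?mulr1 ?mulr0.
case: (boolP (S \subset U)) => [SU|SNU]; last first.
  rewrite big1 => [|S1 S1U]; last first.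
    rewrite !ffunE; case: eqP => [S1S|_]; last by rewrite mulr0 mul0r.
    by rewrite -S1S S1U in SNU.
  case: ifP => // /andP[_ /eqP eqU].
  by rewrite eqU subsetUl in SNU.
rewrite (bigD1 S) //= big1 => [|S1 /andP[_ /negPf S1S]]; last first.
  by rewrite !ffunE S1S mulr0 mul0r.
rewrite !ffunE eqxx mulr1 addr0.
have -> : [disjoint S & T] && (U == S :|: T) = (U :\: S == T).
  apply/andP/eqP => [[dST /eqP->]|<-].
    by rewrite setDUl setDv set0U; apply/setDidPl; rewrite disjoint_sym.
  split; first by apply/pred0P => x /=; rewrite !inE; case: (x \in S).
  apply/eqP/setP => x; rewrite !inE.
  by case: (boolP (x \in S)) => //= /(subsetP SU).
by case: eqP => [->|_]; rewrite ?mulr1 ?mulr0.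
Qed.

Lemma ygen_sqr0 i : ygen i * ygen i = 0.
Proof. by rewrite ybasM -setI_eq0 setIid -cards_eq0 cards1. Qed.

Lemma ygen_anticomm i j : ygen i * ygen j = - (ygen j * ygen i).
Proof.
have [->|ij] := eqVneq i j; first by rewrite ygen_sqr0 oppr0.
have inv1 (k l : 'I_n) : ext_inv [set k] [set l] = (l < k)%N.
  rewrite /ext_inv; case: (boolP (l < k)%N) => lk.
    rewrite (_ : [set _ in _ | _] = [set (k, l)]) ?cards1 //.
    apply/setP => -[s t]; rewrite !inE xpair_eqE /=.
    by case: eqP => //= ->; case: eqP => //= ->.
  apply: eq_card0 => -[s t]; rewrite !inE /=.
  by case: eqP => //= ->; case: eqP => //= ->; apply/negbTE.
rewrite !ybasM !disjoints1 !inE [j == i]eq_sym (negPf ij) setUC !inv1.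
rewrite -scaleNr; congr (_ *: _).
by case: ltngtP ij => [||/val_inj ->]; rewrite ?eqxx //= ?expr0 ?expr1 ?opprK.
Qed.

Definition ylin (k : 'I_n -> R) : A := \sum_i k i *: ygen i.

Lemma ext_scaleMM (k h : R) a b : (k *: a) * (h *: b) = (k * h) *: (a * b).
Proof. by rewrite -ext_scaleAl -ext_scaleAr scalerA. Qed.

Lemma ylin_anticomm k h : ylin k * ylin h = - (ylin h * ylin k).
Proof.
rewrite /ylin !mulr_suml -sumrN.
under eq_bigr do rewrite mulr_sumr.
under [RHS]eq_bigr do rewrite mulr_sumr -sumrN.
rewrite exchange_big; apply: eq_bigr => i _; apply: eq_bigr => j _.
by rewrite !ext_scaleMM ygen_anticomm scalerN mulrC.
Qed.

Lemma ylin_sqr0 k : ylin k * ylin k = 0.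
Proof.
suff [] : ylin k * ylin k = 0 /\
  forall i, ygen i * ylin k = - (ylin k * ygen i) by [].
rewrite /ylin; elim/big_rec: _ => [|j x _ [x0 xA]].
  by split=> [|i]; rewrite ?mul0r ?mulr0 ?oppr0.
split=> [|i]; last first.
  rewrite mulrDr mulrDl xA -ext_scaleAr -ext_scaleAl ygen_anticomm scalerN.
  by rewrite opprD.
rewrite mulrDr !mulrDl x0 addr0 ext_scaleMM ygen_sqr0 scaler0 add0r.
by rewrite -ext_scaleAr -ext_scaleAl xA scalerN addrC addNr.
Qed.

Lemma ylin_prod_comm k (h : 'I_n -> 'I_n -> R) (s : seq 'I_n) :
  ylin k * \prod_(j <- s) ylin (h j) =
  (-1) ^+ size s *: (\prod_(j <- s) ylin (h j) * ylin k).
Proof.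
elim: s => [|j s IHs]; first by rewrite !big_nil mul1r scale1r mulr1.
rewrite !big_cons mulrA ylin_anticomm mulNr -[in LHS]mulrA IHs /= exprS mulN1r.
by rewrite -ext_scaleAr scaleNr mulrA.
Qed.

Lemma enum_set_split S (i : 'I_n) :
  enum S = [seq j : 'I_n <- enum S | (j < i)%N]
           ++ (if i \in S then [:: i] else [::])
           ++ [seq j : 'I_n <- enum S | (i < j)%N].
Proof.
have tr : transitive (fun i j : 'I_n => (i < j)%N).
  by move=> ? ? ?; apply: ltn_trans.
have sS : sorted (fun i j : 'I_n => (i < j)%N) (enum S).
  rewrite {1}/enum_mem; apply: sorted_filter => //.
  rewrite -enumT; have := iota_ltn_sorted 0 n.
  by rewrite -val_enum_ord sorted_map.
apply: (irr_sorted_eq tr) => //.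
- by move=> ?; rewrite ltnn.
- rewrite (sorted_pairwise tr) !pairwise_cat -!(sorted_pairwise tr).
  rewrite !(sorted_filter tr _ sS) /= andbT; apply/and3P; split.
  + apply/allrelP => x y; rewrite mem_cat !mem_filter => /andP[xi _].
    case/orP=> [|/andP[iy _]]; last exact: ltn_trans xi iy.
    by case: ifP => //= _; rewrite inE => /eqP->.
  + apply/allrelP => x y; rewrite mem_filter => + /andP[iy _].
    by case: ifP => //= _; rewrite inE => /eqP->.
  + by case: ifP.
move=> x; have := mem_enum S x; move: (enum S) => s sE.
rewrite !mem_cat !mem_filter !sE; case: ltngtP => /= xi.
- by case: ifP => _; rewrite ?inE ?orbF //; case: eqP xi => [->|]; rewrite ?ltnn ?orbF.
- by case: ifP => _; rewrite ?inE //; case: eqP xi => [->|]; rewrite ?ltnn.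
- by rewrite (ord_inj xi); case: ifP => //; rewrite ?inE ?eqxx.
Qed.

Lemma ylin_prod_insert (h : 'I_n -> 'I_n -> R) i T :
  ylin (h i) * \prod_(j <- enum T) ylin (h j) =
  if i \in T then 0 else
  (-1) ^+ ext_inv [set i] T *: \prod_(j <- enum (i |: T)) ylin (h j).
Proof.
rewrite (enum_set_split T i) !big_cat /= mulrA ylin_prod_comm -ext_scaleAl.
case: ifP => iT.
  by rewrite big_seq1 -[_ * _ * _]mulrA [X in _ * X]mulrA ylin_sqr0 mul0r mulr0 scaler0.
rewrite big_nil mul1r (enum_set_split (i |: T) i) setU11 !big_cat big_seq1 /=.
have e1 : [seq j : 'I_n <- enum (i |: T) | (j < i)%N] = [seq j : 'I_n <- enum T | (j < i)%N].
  rewrite /enum_mem -!filter_predI; apply: eq_filter => j /=.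
  by rewrite !inE; case: eqP => // ->; rewrite ltnn.
have e2 : [seq j : 'I_n <- enum (i |: T) | (i < j)%N] = [seq j : 'I_n <- enum T | (i < j)%N].
  rewrite /enum_mem -!filter_predI; apply: eq_filter => j /=.
  by rewrite !inE; case: eqP => // ->; rewrite ltnn.
rewrite e1 e2 -mulrA; congr (_ ^+ _ *: _).
rewrite /ext_inv.
have -> : [set st in setX [set i] T | (st.2 < st.1)%N]
        = [set (i, j) | j in [set j in T | (j < i)%N]].
  apply/setP => -[s t]; apply/idP/imsetP => [|[j + [-> ->]]]; rewrite !inE /=.
    by case: eqP => //= -> ?; exists t; rewrite ?inE.
  by rewrite eqxx.
rewrite card_imset; last by move=> ? ? [].
rewrite cardE.
by congr size; rewrite /enum_mem -!filter_predI; apply: eq_filter => j /=; rewrite !inE andbC.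
Qed.

Lemma ylin_prodM (h : 'I_n -> 'I_n -> R) S T :
  \prod_(i <- enum S) ylin (h i) * \prod_(j <- enum T) ylin (h j) =
  if [disjoint S & T] then
    (-1) ^+ ext_inv S T *: \prod_(i <- enum (S :|: T)) ylin (h i)
  else 0.
Proof.
pose L S := \prod_(i <- enum S) ylin (h i); rewrite -!/(L _).
have [m] := ubnP #|S|; elim: m S => // m IHm S Sm.
have [->|[i iS]] := set_0Vmem S.
  rewrite /L enum_set0 big_nil mul1r -setI_eq0 set0I eqxx set0U.
  by rewrite ext_inv0l scale1r.
set S' := S :\ i; have iS' : i \notin S' by rewrite !inE eqxx.
have sgnK (e : nat) a : (-1) ^+ e *: ((-1) ^+ e *: a) = a.
  by rewrite scalerA -exprD addnn -mul2n exprM sqrrN !expr1n scale1r.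
have LS : L S = (-1) ^+ ext_inv [set i] S' *: (ylin (h i) * L S').
  by rewrite ylin_prod_insert (negPf iS') sgnK setD1K.
have S'm : (#|S'| < m)%N by move: Sm; rewrite (cardsD1 i S) iS.
rewrite LS -ext_scaleAl -mulrA IHm // -[in RHS](setD1K iS) -/S'.
have -> : [disjoint i |: S' & T] = (i \notin T) && [disjoint S' & T].
  by rewrite -!setI_eq0 setIUl setU_eq0 !setI_eq0 disjoints1.
case: (boolP [disjoint S' & T]) => dST; last by rewrite andbF mulr0 scaler0.
rewrite andbT -ext_scaleAr ylin_prod_insert inE (negPf iS') /=.
case: ifP => iT /=; first by rewrite !scaler0.
rewrite ext_invUr // ext_invUl ?disjoints1 // setUA !exprD.
rewrite -!scalerA [X in _ *: X]scalerA mulrC -scalerA sgnK scalerA mulrC.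
by rewrite scalerA.
Qed.

End ExteriorAlgebra.

(* Indices are 0-based: 'I_n stands for {1, ..., n}, and B(n) is represented  *)
(* by {set 'I_n}, a set S standing for the increasing sequence enum S.        *)

Definition composition (I : seq nat) (n : nat) : Prop :=
  all (leq 1) I /\ sumn I = n.

(* m_j <= s < m_(j+1) for j = reshape_index I s, and then tau I s = m_j. *)
Definition tau (I : seq nat) (s : nat) : nat :=
  sumn (take (reshape_index I s) I).

Definition tau_set (I : seq nat) (n : nat) (S : {set 'I_n}) : nat :=
  last 0%N [seq tau I (val s) | s <- enum S].

Section Invariants.
Variables (F : finFieldType) (n : nat).
Local Notation P := {mpoly F[n]}.
Local Notation A := (extalg (mpoly n F) n).
Implicit Types (g : 'M[F]_n) (I : seq nat) (S : {set 'I_n}).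

Definition actP g (f : P) : P :=
  f \mPo [tuple \sum_i g i j *: 'X_i | j < n].

Definition lin_ygen g (j : 'I_n) : A := ylin (fun i => (g i j)%:MP : P).

Definition actA g (a : A) : A :=
  \sum_(S : {set 'I_n}) actP g (a S) *: \prod_(s <- enum S) lin_ygen g s.

Lemma actP_X g j : actP g 'X_j = \sum_i g i j *: 'X_i.
Proof. by rewrite /actP comp_mpolyXU -tnth_nth tnth_mktuple. Qed.

Lemma actA_additive g : {morph actA g : a b / a + b}.
Proof.
move=> a b; rewrite -big_split; apply: eq_bigr => S _.
by rewrite ffunE /actP comp_mpolyD scalerDl.
Qed.

Lemma actA_scale g c a : actA g (c *: a) = actP g c *: actA g a.
Proof.
rewrite scaler_sumr; apply: eq_bigr => S _.
by rewrite ffunE scalerA /actP -rmorphM.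
Qed.

Lemma actA_ybas g S : actA g (ybas P S) = \prod_(s <- enum S) lin_ygen g s.
Proof.
rewrite /actA (bigD1 S) //= [X in _ + X]big1 => [|T TS].
  by rewrite ybasE eqxx addr0 /actP comp_mpoly1 scale1r.
by rewrite ybasE (negPf TS) /actP comp_mpoly0 scale0r.
Qed.

Lemma actA_ygen g j : actA g (ygen P j) = lin_ygen g j.
Proof. by rewrite actA_ybas enum_set1 big_seq1. Qed.

Lemma actA_1 g : actA g 1 = 1.
Proof.
have -> : 1 = ybas P set0 :> A by apply/ffunP => S; rewrite !ffunE.
by rewrite actA_ybas enum_set0 big_nil.
Qed.

Lemma actA_sum g (J : finType) (c : J -> P) (b : J -> A) :
  actA g (\sum_j c j *: b j) = \sum_j actP g (c j) *: actA g (b j).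
Proof.
elim/big_rec2: _ => [|j x y _ <-]; last by rewrite actA_additive actA_scale.
by apply: (addrI (actA g 0)); rewrite -actA_additive !addr0.
Qed.

Lemma actA_mul g : {morph actA g : a b / a * b}.
Proof.
move=> a b; rewrite [in LHS](ext_basisE a) [in LHS](ext_basisE b) mulr_suml.
under eq_bigr => S _.
  rewrite -ext_scaleAl mulr_sumr.
  under eq_bigr do rewrite -ext_scaleAr.
  over.
rewrite actA_sum mulr_suml; apply: eq_bigr => S _.
rewrite actA_sum -ext_scaleAl; congr (_ *: _).
rewrite mulr_sumr; apply: eq_bigr => T _; rewrite -ext_scaleAr; congr (_ *: _).
rewrite ybasM ylin_prodM; case: ifP => _.
  rewrite actA_scale actA_ybas; congr (_ *: _).
  by rewrite /actP rmorphXn rmorphN1.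
by apply: (addrI (actA g 0)); rewrite -actA_additive !addr0.
Qed.

Definition UI I : {set 'M[F]_n} :=
  [set g : 'M[F]_n | [forall i : 'I_n, forall j : 'I_n,
     ((reshape_index I i == reshape_index I j) ==> (g i j == (i == j)%:R)) &&
     ((reshape_index I j < reshape_index I i)%N ==> (g i j == 0))]].

Definition invP I : {pred P} := [pred f : P | [forall g in UI I, actP g f == f]].

Definition invA I : {pred A} := [pred a : A | [forall g in UI I, actA g a == a]].

Lemma invP_subring I : subring_closed (invP I).
Proof.
split=> [|f h /forall_inP fU /forall_inP hU|f h /forall_inP fU /forall_inP hU];
  apply/forall_inP => g gU; apply/eqP; rewrite /actP.
- exact: rmorph1.
- by rewrite rmorphB; congr (_ - _); apply/eqP; [apply: fU | apply: hU].
- by rewrite rmorphM; congr (_ * _); apply/eqP; [apply: fU | apply: hU].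
Qed.

Lemma invA_submod I c a b :
  c \in invP I -> a \in invA I -> b \in invA I -> c *: a + b \in invA I.
Proof.
move=> /forall_inP cU /forall_inP aU /forall_inP bU; apply/forall_inP => g gU.
by rewrite actA_additive actA_scale (eqP (cU _ gU)) (eqP (aU _ gU)) (eqP (bU _ gU)).
Qed.

Lemma UI_unitmx I g : g \in UI I -> g \in unitmx.
Proof.
rewrite inE => /forallP gU; rewrite unitmxE -det_tr det_trig; last first.
  apply/is_trig_mxP => i j ij; rewrite mxE.
  have := reshape_leq I i j; rewrite (ltnW ij) => /esym ilej.
  have /forallP/(_ i)/andP[/implyP gd /implyP gl] := gU j.
  case: ltngtP ilej gd gl => //= _ _ gd gl; first exact/eqP/gl.
  by rewrite (eqP (gd isT)) -val_eqE /= gtn_eqF.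
rewrite big1 ?unitr1 // => i _; rewrite mxE.
by have /forallP/(_ i)/andP[] := gU i; rewrite eqxx => /eqP->; rewrite eqxx.
Qed.

(* v_{i,j} is vpoly I s for s the (0-based) position m_(i-1) + j - 1, so that *)
(* tau I s = m_(i-1); lam is the vector of the lambda_c, c < m_(i-1).         *)
Definition vpoly I (s : 'I_n) : P :=
  \prod_(lam : {ffun {c : 'I_n | (c < tau I s)%N} -> F})
     (\sum_c lam c *: 'X_(val c) + 'X_s).

(* The columns 1, ..., b, a_1, ..., a_t: for b <= n there are b + t of them,  *)
(* and enum_val lists them in increasing order.                               *)
Definition Ncols (b : nat) S : {set 'I_n} :=
  [set c : 'I_n | (c < b)%N || (c \in S)].

Definition Nexps (b : nat) S : seq nat :=
  [seq e <- iota 0 b | e \notin [seq val s | s <- enum S]].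

(* k + t = #|S| *)
Definition Nmat (q b : nat) S : 'M[A]_#|Ncols b S| :=
  \matrix_(i, j)
    let c := enum_val j in
    if (i < #|S|)%N then ygen P c
    else ('X_c ^+ (q ^ nth 0%N (Nexps b S) (i - #|S|)))%:A.

(* The row determinant of Nmat divided by #|S|`!: the #|S| first rows are     *)
(* equal with anticommuting entries, so the terms of the row determinant are  *)
(* constant on the classes of the permutations modulo those of these rows.    *)
Definition Nform (q b : nat) S : A :=
  if S == set0 then 1 else
  \sum_(sigma : 'S_#|Ncols b S| |
        [forall i : 'I_#|Ncols b S|, forall j : 'I_#|Ncols b S|,
           (i < j < #|S|)%N ==> (sigma i < sigma j)%N])
     (-1) ^+ sigma * \prod_i Nmat q b S i (sigma i).

End Invariants.

(* Main.v *)
Require Import Defs.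
From HB Require Import structures.
From mathcomp Require Import all_boot all_order all_algebra all_fingroup.
From mathcomp Require Import finfield pgroup abelian ring zify.
From mathcomp.multinomials Require Import mpoly.

Set Implicit Arguments.
Unset Strict Implicit.
Unset Printing Implicit Defensive.

Import GRing.Theory.
Local Open Scope ring_scope.

(** Let iota_e be the contraction of the exterior algebra over P with
    iota_e(y_j) = x_j^(q^e).  As Frobenius is additive and F_q-linear, iota_e
    commutes with every linear substitution, singular ones included.  Up to
    sign, N_{b,S} is obtained from y_1 ... y_b y_{a_1} ... y_{a_t} by applying
    the iota_e with e < b and e + 1 not in S; invariance follows at once.
    Applying the remaining iota_e to N_{b,S} and reading off the coefficient of
    y_{a_1} ... y_{a_t} gives the Moore determinant L_b, up to sign, and gives 0
    for any other S: this dual system yields freeness.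

    For generation, remove the last variables x_s, y_s.  An invariant f that
    vanishes for x_s = y_s = 0 vanishes under all substitutions
    x_s := mu.x, y_s := mu.y with mu in F_q^b, b = tau(s).  A polynomial with
    this property is divisible by v_s.  In the exterior algebra, write
    f = r + y_s d, and let alpha be d at x_s = y_s = 0.  Then
    r(mu.x) = - (mu.y) alpha, hence mu.x divides (mu.y) alpha for all mu.  It
    follows that L_b, a product of such linear forms, divides the dual
    coefficients of alpha, so that alpha is a combination of the N_{b,S}.
    Subtracting the same combination of the N_{b,S + s} from f makes all
    coefficients divisible by v_s, and one concludes by induction on the degree
    in x_s. *)

(** * Contractions of the exterior algebra *)

(** Killing the variables from some index on and reducing modulo x_c - lam.x are both actions of
    singular matrices, so that matrix identities replace computations with polynomials. An invariant
    f in the first s variables equals its translate under x_s := x_s + mu.x, hence takes the same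
    value at x_s := mu.x as at x_s := 0; U_I contains these translations exactly for mu in F_q^b
    with b = tau(s). The same b makes y_1 ... y_b y_S invariant: to y_j a group element adds only
    terms y_i with i <= tau(j), a factor already present. Modulo mu.x the form mu.y is killed by
    every iota_e, since iota_e(mu.y) = (mu.x)^(q^e). Multiplication by mu.y therefore anticommutes
    with all iota_e, and (mu.y) alpha = 0 passes to all contractions of alpha. Coprimality of the
    factors of L_b is replaced by nonvanishing specializations. Division by v_s lowers the degree in
    x_s because the forms N_{b,S + s} involve only exponents q^e with e < b: their degree in x_s is
    below q^b, the degree of v_s. Signs never matter and stay existentially quantified. *)

Section Contraction.
Variables (R : comNzRingType) (n : nat).
Local Notation A := (extalg R n).
Implicit Types (S T U : {set 'I_n}) (a : A) (k h : 'I_n -> R) (i j : 'I_n).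

Lemma ext_inv11 i j : ext_inv [set i] [set j] = (j < i)%N.
Proof.
rewrite /ext_inv; case: (boolP (j < i)%N) => ji.
  rewrite (_ : [set _ in _ | _] = [set (i, j)]) ?cards1 //.
  apply/setP => -[s t]; rewrite !inE xpair_eqE /=.
  by case: eqP => //= ->; case: eqP => //= ->.
apply: eq_card0 => -[s t]; rewrite !inE /=.
by case: eqP => //= ->; case: eqP => //= ->; apply/negbTE.
Qed.

Lemma ybas0 : ybas R set0 = 1 :> A.
Proof. by apply/ffunP => S; rewrite !ffunE. Qed.

Lemma ext_1E U : (1 : A) U = (U == set0)%:R.
Proof. by rewrite -ybas0 ybasE. Qed.

Lemma ygenM_ybas j U : j \notin U ->
  ygen R j * ybas R U = (-1) ^+ ext_inv [set j] U *: ybas R (j |: U) :> A.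
Proof. by move=> jU; rewrite ybasM disjoints1 jU. Qed.

Lemma ygenM_ybas_sign j U : j \notin U ->
  ybas R (j |: U) = (-1) ^+ ext_inv [set j] U *: (ygen R j * ybas R U) :> A.
Proof. by move=> jU; rewrite ygenM_ybas // scalerA -expr2 sqrr_sign scale1r. Qed.

(** Reduces identities between operators to their commutation with one generator, sparing most
    computations with the signs [ext_inv]. *)
Lemma ext_ind (P : A -> Prop) :
    (forall a b, P a -> P b -> P (a + b)) -> (forall c a, P a -> P (c *: a)) ->
    P 1 -> (forall j a, P a -> P (ygen R j * a)) ->
  forall a, P a.
Proof.
move=> PD PZ P1 PM a; rewrite (ext_basisE a).
have P0 : P 0 by rewrite -(scale0r 1); apply: PZ.
elim/big_ind: _ => // S _; apply: (PZ).
have [m] := ubnP #|S|; elim: m S => // m IHm S Sm.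
have [->|[i iS]] := set_0Vmem S; first by rewrite ybas0.
have iS' : i \notin S :\ i by rewrite !inE eqxx.
rewrite -(setD1K iS) ygenM_ybas_sign //; apply/PZ/PM/IHm.
by move: Sm; rewrite (cardsD1 i S) iS.
Qed.

Lemma ygenME j a U : (ygen R j * a) U =
  if j \in U then (-1) ^+ ext_inv [set j] (U :\ j) * a (U :\ j) else 0.
Proof.
rewrite [LHS]ffunE; case: ifP => jU.
  rewrite (bigD1 [set j]) ?sub1set //= big1 => [|S /andP[_ /negPf Sj]].
    by rewrite ybasE eqxx mulr1 addr0.
  by rewrite ybasE Sj mulr0 mul0r.
rewrite big1 // => S SU; rewrite ybasE; case: eqP SU => [->|_ _].
  by rewrite sub1set jU.
by rewrite mulr0 mul0r.
Qed.

Lemma ext_addE a b U : (a + b) U = a U + b U. Proof. exact: ffunE. Qed.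

Lemma ext_oppE a U : (- a) U = - a U. Proof. exact: ffunE. Qed.

Lemma ext_scaleE c a U : (c *: a) U = c * a U. Proof. exact: ffunE. Qed.

Lemma ext_scalar_inj (x y : R) : x%:A = y%:A :> A -> x = y.
Proof. by move=> /(congr1 (fun a : A => a set0)); rewrite !ext_scaleE ext_1E eqxx !mulr1. Qed.

(** The antiderivation sending y_j to [k j], given by its coefficients; the sign comes from moving
    y_j to the front of the monomial on [j |: U]. *)
Definition contr k a : A := [ffun U : {set 'I_n} =>
  \sum_(j | j \notin U) (-1) ^+ ext_inv [set j] U * k j * a (j |: U)].

Lemma contrE k a U : contr k a U =
  \sum_(j | j \notin U) (-1) ^+ ext_inv [set j] U * k j * a (j |: U).
Proof. exact: ffunE. Qed.

Lemma contr_is_linear k : linear (contr k).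
Proof.
move=> c a b; apply/ffunP => U; rewrite !ffunE scaler_sumr -big_split /=.
apply: eq_bigr => j _; rewrite !ffunE /GRing.scale /=; ring.
Qed.

HB.instance Definition _ k := GRing.isLinear.Build R A A *:%R (contr k) (contr_is_linear k).

Lemma contrD k a b : contr k (a + b) = contr k a + contr k b.
Proof. exact: linearD. Qed.

Lemma contrB k a b : contr k (a - b) = contr k a - contr k b.
Proof. exact: linearB. Qed.

Lemma contrZ k c a : contr k (c *: a) = c *: contr k a.
Proof. exact: linearZ. Qed.

Lemma contr_scale k (c e e' : R) a b u : a = e *: b -> contr k b = e' *: u ->
  contr k (c *: a) = (c * (e * e')) *: u.
Proof. by move=> -> kb; rewrite !contrZ kb !scalerA mulrA. Qed.

Lemma contr1 k : contr k 1 = 0.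
Proof.
apply/ffunP => U; rewrite !ffunE big1 // => j _; rewrite ffunE.
by rewrite setU_eq0 -cards_eq0 cards1 mulr0.
Qed.

Lemma contr_ygenM k j a : contr k (ygen R j * a) = k j *: a - ygen R j * contr k a.
Proof.
apply/ffunP => U; rewrite ext_addE ext_oppE ext_scaleE !contrE ygenME.
case: (boolP (j \in U)) => jU.
  (* The term of index [j] cancels [k j * a U]; the remaining terms differ from those on the left by
     the sign of exchanging y_i and y_j. *)
  rewrite contrE [in RHS](bigD1 j) ?inE ?eqxx //= setD1K // mulrDr.
  rewrite -[_ ^+ _ * k j * _]mulrA [X in - (X + _)]mulrA -expr2 sqrr_sign mul1r opprD.
  rewrite [_ + (- _ + _)]addrA subrr add0r mulr_sumr -sumrN.
  apply: eq_big => [i|i iU].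
    by rewrite !inE negb_and negbK; case: eqP => [->|]; rewrite ?jU ?andbF ?andbT.
  have ij : i != j by apply: contraNneq iU => ->.
  rewrite ygenME !inE jU orbT.
  have -> : (i |: U) :\ j = i |: (U :\ j).
    by apply/setP => x; rewrite !inE; case: (x =P i) => // ->; rewrite ij.
  rewrite -[in ext_inv [set i] U](setD1K jU) !ext_invUr ?ext_inv11; last 2 first.
  - by rewrite disjoints1 !inE (negPf iU) andbF.
  - by rewrite disjoints1 !inE eqxx.
  have [ij'|ij'|/val_inj ij'] := ltngtP i j; last by rewrite ij' eqxx in ij.
    by rewrite !exprD /=; ring.
  by rewrite !exprD /=; ring.
rewrite subr0 (bigD1 j) //= ygenME setU11 big1 => [|i /andP[_ ij]].
  by rewrite addr0 setU1K // mulrACA -expr2 sqrr_sign mul1r.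
by rewrite ygenME !inE eq_sym (negPf ij) (negPf jU) mulr0.
Qed.

Lemma contr_ylinM k c a :
  contr k (ylin c * a) = (\sum_i c i * k i) *: a - ylin c * contr k a.
Proof.
rewrite /ylin !mulr_suml linear_sum scaler_suml -sumrB; apply: eq_bigr => i _.
by rewrite -!ext_scaleAl linearZ /= contr_ygenM scalerBr scalerA.
Qed.

Lemma contr_anticomm k h a : contr k (contr h a) = - contr h (contr k a).
Proof.
elim/ext_ind: a => [a b Ha Hb|c a Ha||j a Ha].
- by rewrite !linearD /= Ha Hb.
- by rewrite !linearZ /= Ha scalerN.
- by rewrite !contr1 !linear0.
rewrite !contr_ygenM !linearB /= !linearZ /= !contr_ygenM Ha mulrN.
by rewrite scalerN !opprK opprD addrCA.
Qed.

Lemma contr_sqr0 k a : contr k (contr k a) = 0.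
Proof.
elim/ext_ind: a => [a b Ha Hb|c a Ha||j a Ha].
- by rewrite !linearD /= Ha Hb addr0.
- by rewrite !linearZ /= Ha scaler0.
- by rewrite !contr1 linear0.
by rewrite contr_ygenM linearB /= linearZ /= contr_ygenM Ha mulr0 subr0 subrr.
Qed.

Definition contrs (ks : seq ('I_n -> R)) a : A := foldl (fun b k => contr k b) a ks.

Lemma contrs_is_linear ks : linear (contrs ks).
Proof.
elim: ks => [|k ks IH] c a b //.
by rewrite /contrs /= contr_is_linear; apply: IH.
Qed.

HB.instance Definition _ ks :=
  GRing.isLinear.Build R A A *:%R (contrs ks) (contrs_is_linear ks).

Lemma contrsZ ks c a : contrs ks (c *: a) = c *: contrs ks a.
Proof. exact: linearZ. Qed.

Lemma contrs_cat ks hs a : contrs (ks ++ hs) a = contrs hs (contrs ks a).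
Proof. exact: foldl_cat. Qed.

Lemma contrs_contr ks k a :
  contrs ks (contr k a) = (-1) ^+ size ks *: contr k (contrs ks a).
Proof.
elim: ks a => [|h ks IH] a /=; first by rewrite scale1r.
by rewrite contr_anticomm linearN /= IH exprS mulN1r scaleNr.
Qed.

Lemma contrsC ks hs a :
  contrs ks (contrs hs a) = (-1) ^+ (size hs * size ks) *: contrs hs (contrs ks a).
Proof.
elim: hs a => [|h hs IH] a /=; first by rewrite scale1r.
by rewrite IH contrs_contr linearZ /= scalerA -exprD addnC.
Qed.

Lemma contrs_mem0 ks k a : contr k a = 0 -> contr k (contrs ks a) = 0.
Proof.
elim: ks a => //= h ks IH a ka; apply: IH.
by rewrite contr_anticomm ka linear0 oppr0.
Qed.

Lemma contr_delta j a U : contr (fun i => (i == j)%:R) a U =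
  if j \in U then 0 else (-1) ^+ ext_inv [set j] U * a (j |: U).
Proof.
rewrite ffunE; case: ifP => jU.
  rewrite big1 // => i iU; have /negPf-> : i != j by apply: contraNneq iU => ->.
  by rewrite mulr0 mul0r.
rewrite (bigD1 j) ?jU //= eqxx mulr1 big1 ?addr0 // => i /andP[_ /negPf->].
by rewrite mulr0 mul0r.
Qed.

Lemma prod_ygenM_comm (s : seq 'I_n) i :
  (\prod_(j <- s) ygen R j) * ygen R i =
  (-1) ^+ size s *: (ygen R i * \prod_(j <- s) ygen R j).
Proof.
elim: s => [|j s IH]; first by rewrite !big_nil mulr1 mul1r scale1r.
rewrite !big_cons -mulrA IH -ext_scaleAr mulrA ygen_anticomm mulNr scalerN -mulrA.
by rewrite /= exprS mulN1r scaleNr.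
Qed.

Lemma prod_ygenM_mem (s : seq 'I_n) i : i \in s ->
  (\prod_(j <- s) ygen R j) * ygen R i = 0.
Proof.
case/path.splitPr=> s1 s2; rewrite big_cat big_cons /= -!mulrA prod_ygenM_comm.
by rewrite -ext_scaleAr [X in _ *: X]mulrA ygen_sqr0 mul0r scaler0 mulr0.
Qed.

(** This is the splitting a = r + y_j d with d the contraction along the j-th coordinate: r consists
    of the monomials without y_j. *)
Lemma subr_ygen_contr_delta j a U :
  (a - ygen R j * contr (fun i => (i == j)%:R) a) U = if j \in U then 0 else a U.
Proof.
rewrite ext_addE ext_oppE ygenME; case: ifP => jU; last by rewrite subr0.
by rewrite contr_delta !inE eqxx setD1K // mulrA -expr2 sqrr_sign mul1r subrr.
Qed.

Lemma coef_contr_delta j a U : j \in U ->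
  a U = (-1) ^+ ext_inv [set j] (U :\ j) * contr (fun i => (i == j)%:R) a (U :\ j).
Proof.
by move=> jU; rewrite contr_delta !inE eqxx setD1K // mulrA -expr2 sqrr_sign mul1r.
Qed.

Definition ltI : rel 'I_n := fun i j => (i < j)%N.

Lemma ltI_trans : transitive ltI.
Proof. by move=> j i k; apply: ltn_trans. Qed.

Lemma sorted_enum S : sorted ltI (enum S).
Proof.
rewrite /enum_mem -enumT; apply: (sorted_filter ltI_trans).
by have := iota_ltn_sorted 0 n; rewrite -val_enum_ord sorted_map.
Qed.

Lemma ext_inv_ltI j (s : seq 'I_n) : path ltI j s -> ext_inv [set j] [set i in s] = 0%N.
Proof.
rewrite (path_sortedE ltI_trans) => /andP[/allP js _].
apply: eq_card0 => -[x y]; rewrite !inE /=; apply/negbTE.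
apply/negP => /andP[/andP[/eqP-> /js]]; rewrite /ltI => /ltnW.
by rewrite leqNgt => /negPf->.
Qed.

Lemma path_ltI_notin j (s : seq 'I_n) : path ltI j s -> j \notin s.
Proof.
rewrite (path_sortedE ltI_trans) => /andP[/allP js _].
by apply/negP => /js; rewrite /ltI ltnn.
Qed.

Lemma prod_ygen_sorted (s : seq 'I_n) : sorted ltI s ->
  \prod_(j <- s) ygen R j = ybas R [set j in s] :> A.
Proof.
elim: s => [_|j s IH js].
  by rewrite big_nil -ybas0; congr ybas; apply/setP => i; rewrite !inE.
rewrite big_cons IH ?(path_sorted js) // ygenM_ybas ?inE ?path_ltI_notin //.
rewrite ext_inv_ltI // scale1r; congr ybas.
by apply/setP => i; rewrite !inE.
Qed.

Lemma prod_ygen_enum S : \prod_(j <- enum S) ygen R j = ybas R S :> A.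
Proof.
rewrite prod_ygen_sorted ?sorted_enum //; congr ybas.
by apply/setP => i; rewrite inE mem_enum.
Qed.

Definition delta j : 'I_n -> R := fun i => (i == j)%:R.

(** In increasing order no sign arises. Coefficients thus become contractions themselves and can be
    exchanged with other contractions. *)
Lemma contrs_delta (s : seq 'I_n) a : sorted ltI s ->
  contrs [seq delta j | j <- s] a set0 = a [set i in s].
Proof.
elim: s a => [|j s IH] a js /=.
  by congr (a _); apply/setP => i; rewrite !inE.
rewrite IH ?(path_sorted js) // contr_delta inE (negPf (path_ltI_notin js)).
rewrite ext_inv_ltI // mul1r; congr (a _).
by apply/setP => i; rewrite !inE.
Qed.

Lemma contr_prod_ygen k m (c : 'I_m.+1 -> 'I_n) :
  contr k (\prod_j ygen R (c j)) =
  \sum_(j < m.+1) ((-1) ^+ j * k (c j)) *: \prod_(i < m) ygen R (c (lift j i)).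
Proof.
elim: m c => [|m IH] c.
  rewrite !big_ord_recl !big_ord0 mulr1 -[ygen _ _]mulr1 contr_ygenM contr1.
  by rewrite mulr0 subr0 addr0 mul1r.
rewrite big_ord_recl contr_ygenM IH [RHS]big_ord_recl mul1r; congr (_ + _).
rewrite mulr_sumr -sumrN; apply: eq_bigr => j _.
rewrite big_ord_recl -ext_scaleAr -scaleNr -mulNr exprS mulN1r; congr (_ *: (_ * _)).
  by congr (ygen _ (c _)); apply: val_inj.
apply: eq_bigr => i _; congr (ygen _ (c _)); apply: val_inj.
by rewrite /= /bump /= !add1n ltnS addnS.
Qed.

(** The first contraction removes one factor of the product with an alternating sign, which is the
    cofactor expansion along the first row. *)
Lemma contrs_det m (k : 'I_m -> 'I_n -> R) (c : 'I_m -> 'I_n) :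
  \det (\matrix_(u, v) k u (c v)) =
  contrs [seq k u | u <- enum 'I_m] (\prod_j ygen R (c j)) set0.
Proof.
elim: m k c => [|m IH] k c.
  by rewrite det_mx00 enum_ord0 big_ord0 /= ffunE eqxx.
rewrite (expand_det_row _ ord0) enum_ordSl /= contr_prod_ygen linear_sum sum_ffunE.
apply: eq_bigr => j _; rewrite linearZ ffunE /= mxE -map_comp.
rewrite -(IH (fun u => k (lift ord0 u)) (fun u => c (lift j u))).
rewrite /cofactor add0n mulrA [k _ _ * _]mulrC; congr (_ * \det _).
by apply/matrixP => x y; rewrite !mxE.
Qed.

End Contraction.

Arguments ltI {n}.
Arguments delta {R n}.

(** * The row determinant as an iterated contraction *)

Section RowDeterminant.
Variables (R : comNzRingType) (n : nat).
Local Notation A := (extalg R n).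
Implicit Types (S T U : {set 'I_n}) (a : A) (k h : 'I_n -> R) (i j : 'I_n).

Lemma contr_neq0 k a U : contr k a U != 0 -> exists2 j, j \notin U & a (j |: U) != 0.
Proof.
rewrite contrE => nz.
have [/existsP[j /andP[]]|/existsPn no] := boolP [exists j, (j \notin U) && (a (j |: U) != 0)].
  by exists j.
case/negP: nz; apply/eqP/big1 => j jU; have := no j.
by rewrite jU negbK => /eqP->; rewrite mulr0.
Qed.

(** Each contraction removes exactly one index from a monomial; this serves as the degree and
    support argument throughout. *)
Lemma contrs_neq0 ks a U : contrs ks a U != 0 ->
  exists V : {set 'I_n}, [/\ [disjoint V & U], #|V| = size ks & a (V :|: U) != 0].
Proof.
elim: ks a => [|k ks IH] a /=.
  by exists set0; rewrite cards0 set0U -setI_eq0 set0I.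
case/IH=> V [dVU cV /contr_neq0[j jVU aj]]; exists (j |: V); split.
- rewrite -setI_eq0 setIUl setU_eq0 !setI_eq0 dVU disjoints1 andbT.
  by apply: contra jVU; rewrite inE orbC => ->.
- by move: jVU; rewrite inE => /norP[jV _]; rewrite cardsU1 jV cV.
- by rewrite -setUA.
Qed.

Lemma prod_natr_bool (J : finType) (b : pred J) :
  \prod_j (b j)%:R = [forall j, b j]%:R :> R.
Proof.
case: (boolP [forall j, b j]) => [/forallP bT|].
  by rewrite big1 // => j _; rewrite bT.
by rewrite negb_forall => /existsP[j /negPf bj]; rewrite (bigD1 j) //= bj mul0r.
Qed.

Lemma sorted_ltI_eq (s t : seq 'I_n) : sorted ltI s -> sorted ltI t -> s =i t -> s = t.
Proof. by apply: irr_sorted_eq => [|j]; [apply: ltI_trans|rewrite /ltI ltnn]. Qed.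

Lemma map_enum_val (U : {set 'I_n}) : [seq enum_val u | u <- enum 'I_#|U|] = enum U.
Proof.
case: (set_0Vmem U) => [->|[j0 _]].
  by apply/eqP; rewrite enum_set0 -size_eq0 size_map size_enum_ord cards0.
apply: (@eq_from_nth _ j0) => [|i]; first by rewrite size_map size_enum_ord cardE.
rewrite size_map size_enum_ord => iU.
rewrite (nth_map (Ordinal iU)) ?size_enum_ord // (enum_val_nth j0).
by rewrite nth_enum_ord.
Qed.

Lemma enum_ord_cat (k m : nat) : enum 'I_(k + m) =
  [seq lshift m u | u <- enum 'I_k] ++ [seq rshift k u | u <- enum 'I_m].
Proof.
apply: (inj_map (@ord_inj (k + m))).
rewrite [LHS](val_enum_ord (k + m)) map_cat iotaD add0n; congr (_ ++ _).
  by rewrite -[RHS]map_comp -(val_enum_ord k); apply: eq_map.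
rewrite -[X in iota X]addn0 iotaDl -(val_enum_ord m).
by rewrite -[LHS]map_comp -[RHS]map_comp; apply: eq_map.
Qed.

Lemma prod_ygen_homo m (c : 'I_m -> 'I_n) : {homo c : u v / (u < v)%N} ->
  \prod_u ygen R (c u) = ybas R [set c u | u in 'I_m] :> A.
Proof.
move=> c_homo; transitivity (\prod_(u <- enum 'I_m) ygen R (c u)).
  by rewrite enumT.
rewrite -(big_map c predT (fun j => ygen R j)) prod_ygen_sorted.
  congr ybas; apply/setP => j; rewrite inE; apply/mapP/imsetP => -[u _ ->]; exists u => //.
  by rewrite mem_enum.
rewrite (@homo_sorted _ _ c (fun u v => (u < v)%N)) //.
by have := iota_ltn_sorted 0 m; rewrite -val_enum_ord sorted_map.
Qed.

Lemma rowdet_term (k m' : nat) (c : 'I_(k + m') -> 'I_n) (x : nat -> 'I_n -> R)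
    (sigma : 'S_(k + m')) : {homo c : u v / (u < v)%N} ->
  (forall u v : 'I_(k + m'), (u < v < k)%N -> (sigma u < sigma v)%N) ->
  \prod_(u < k + m') (if (u < k)%N then ygen R (c (sigma u))
                      else (x (u - k)%N (c (sigma u)))%:A : A) =
  (\prod_(u < m') x u (c (sigma (rshift k u)))) *:
    ybas R [set c (sigma (lshift m' u)) | u in 'I_k].
Proof.
move=> c_homo incr; rewrite big_split_ord /=.
have -> : \prod_(u < k) (if (u < k)%N then ygen R (c (sigma (lshift m' u)))
     else (x (u - k)%N (c (sigma (lshift m' u))))%:A : A)
     = \prod_(u < k) ygen R (c (sigma (lshift m' u))).
  by apply: eq_bigr => u _; rewrite ltn_ord.
have -> : \prod_(u < m') (if (k + u < k)%N then ygen R (c (sigma (rshift k u)))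
     else (x (k + u - k)%N (c (sigma (rshift k u))))%:A : A)
   = (\prod_(u < m') x u (c (sigma (rshift k u))))%:A.
  rewrite -[RHS]/(in_alg A _) rmorph_prod; apply: eq_bigr => u _.
  by rewrite ltnNge leq_addr addKn.
rewrite mulr_algr prod_ygen_homo // => u v uv; apply/c_homo/incr.
by rewrite /= uv ltn_ord.
Qed.

(* The coefficient of y_U in the row determinant is a commutative determinant,
   whose first rows are the unit vectors of the elements of U: the terms of
   permutations that are not increasing on these rows vanish. *)
Lemma rowdet_coef m' (U : {set 'I_n}) (c : 'I_(#|U| + m') -> 'I_n) (x : nat -> 'I_n -> R)
    (sigma : 'S_(#|U| + m')) : {homo c : u v / (u < v)%N} ->
  (if [forall u : 'I_(#|U| + m'), forall v : 'I_(#|U| + m'),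
         (u < v < #|U|)%N ==> (sigma u < sigma v)%N]
   then (\prod_(u < #|U| + m') (if (u < #|U|)%N then ygen R (c (sigma u))
          else (x (u - #|U|)%N (c (sigma u)))%:A : A)) U else 0) =
  \prod_u (match split u with inl u => delta (enum_val u) | inr v => x v end) (c (sigma u)).
Proof.
move=> c_homo.
have c_mono : {mono c : u v / (u < v)%N}.
  move=> u v; apply/idP/idP => [|/c_homo//].
  case: (ltngtP u v) => // [/c_homo|/val_inj->]; rewrite ?ltnn // => /ltnW.
  by rewrite leqNgt => /negPf->.
pose d (u : 'I_#|U|) := c (sigma (lshift m' u)).
rewrite [RHS]big_split_ord /=.
under [X in _ = X * _]eq_bigr do rewrite (unsplitK (inl _)).
under [X in _ = _ * X]eq_bigr do rewrite (unsplitK (inr _)).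
rewrite prod_natr_bool -/(d _).
have enum_val_mono (u v : 'I_#|U|) : (u < v)%N -> (enum_val u < enum_val v)%N.
  move=> uv; have j0 := enum_val u; rewrite !(enum_val_nth j0).
  by apply: (sorted_ltn_nth (@ltI_trans n) j0 (sorted_enum U)); rewrite ?inE -?cardE.
case: ifPn => [incr|nincr]; last first.
  case: (boolP [forall u, _]); last by rewrite mul0r.
  move=> /forallP dE; case/negP: nincr; apply/forallP => u; apply/forallP => v.
  apply/implyP => /andP[uv vk]; have uk := ltn_trans uv vk.
  rewrite -c_mono; have := enum_val_mono (Ordinal uk) (Ordinal vk) uv.
  rewrite -(eqP (dE (Ordinal uk))) -(eqP (dE (Ordinal vk))).
  by congr (c (sigma _) < c (sigma _))%N; apply: val_inj.
have {}incr (u v : 'I_(#|U| + m')) : (u < v < #|U|)%N -> (sigma u < sigma v)%N.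
  by move/forallP/(_ u)/forallP/(_ v)/implyP: incr.
rewrite rowdet_term // ext_scaleE mulrC; congr (_ * _); rewrite ybasE; congr (_%:R).
have enumE := map_enum_val U.
apply: congr1; apply/eqP/forallP => [Ud u|dE].
  suff : [seq d u | u <- enum 'I_#|U|] = enum U.
    by rewrite -enumE => /eq_in_map/(_ u); rewrite mem_enum => /(_ isT) duE; apply/eqP.
  apply: sorted_ltI_eq => [||j]; rewrite ?sorted_enum //.
    rewrite (@homo_sorted _ _ d (fun u v => (u < v)%N)) //.
      by move=> v w vw; rewrite /ltI /d c_mono incr //= vw ltn_ord.
    by have := iota_ltn_sorted 0 #|U|; rewrite -val_enum_ord sorted_map.
  rewrite mem_enum [in RHS]Ud; apply/mapP/imsetP => -[v _ ->]; exists v => //.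
  by rewrite mem_enum.
apply/setP => j; rewrite -mem_enum -enumE; apply/mapP/imsetP => -[v _ ->]; exists v => //.
  by rewrite -(eqP (dE v)).
all: by rewrite ?mem_enum -?(eqP (dE v)).
Qed.

(** Coefficients of y_U are compared. For [#|U| = k] the left side is a commutative determinant,
    hence a contraction by the unit vectors of U followed by the rows [x]; exchanging the two
    families produces the sign, after which the unit vectors read off the coefficient. For other U
    both sides vanish for degree reasons. *)
Lemma rowdet_contrs (m k m' : nat) (c : 'I_m -> 'I_n) (x : nat -> 'I_n -> R) :
    m = (k + m')%N -> {homo c : u v / (u < v)%N} ->
  \sum_(sigma : 'S_m | [forall u : 'I_m, forall v : 'I_m,
           (u < v < k)%N ==> (sigma u < sigma v)%N])
     (-1) ^+ sigma * \prod_(u < m) (if (u < k)%N then ygen R (c (sigma u))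
                              else (x (u - k)%N (c (sigma u)))%:A : A) =
  (-1) ^+ (k * m') *: contrs (map x (iota 0 m')) (ybas R [set c u | u in 'I_m]).
Proof.
move=> mk; subst m => c_homo; rewrite -prod_ygen_homo //; apply/ffunP => U.
rewrite sum_ffunE ext_scaleE.
have [Uk|Uk] := eqVneq #|U| k.
  subst k; pose D (u : 'I_(#|U| + m')) :=
    match split u with inl u => delta (enum_val u) | inr v => x v end.
  transitivity (\det (\matrix_(u, v) D u (c v))).
    rewrite big_mkcond; apply: eq_bigr => sigma _ /=.
    transitivity ((-1) ^+ sigma * \prod_u D u (c (sigma u))); last first.
      by congr (_ * _); apply: eq_bigr => u _; rewrite mxE.
    rewrite -rowdet_coef //; case: ifP => _; last by rewrite mulr0.
    by case: (odd_perm sigma); rewrite ?expr1 ?expr0 ?mulN1r ?mul1r // ffunE.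
  have DE : [seq D u | u <- enum 'I_(#|U| + m')] =
      [seq delta j | j <- enum U] ++ (map x (iota 0 m')).
    rewrite enum_ord_cat map_cat; congr (_ ++ _).
      rewrite -[LHS]map_comp -(map_enum_val U) -[RHS]map_comp.
      by apply: eq_map => u /=; rewrite /D (unsplitK (inl _)).
    rewrite -[LHS]map_comp -(val_enum_ord m') -[RHS]map_comp.
    by apply: eq_map => u /=; rewrite /D (unsplitK (inr _)).
  rewrite contrs_det DE contrs_cat contrsC ext_scaleE !size_map size_iota -cardE mulnC.
  congr (_ * _).
  rewrite contrs_delta ?sorted_enum //; congr (_ _).
  by apply/setP => j; rewrite inE mem_enum.
rewrite big1 => [|sigma /forallP incr]; last first.
  rewrite rowdet_term // => [|u v]; last by have /forallP/(_ v)/implyP := incr u.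
  suff W0 : (U == [set c (sigma (lshift m' u)) | u in 'I_k]) = false.
    by case: (odd_perm sigma); rewrite ?expr1 ?expr0 ?mulN1r ?mul1r ?ext_oppE
      ext_scaleE ybasE W0 mulr0 ?oppr0.
  apply: contraNF Uk => /eqP->; rewrite card_imset ?card_ord // => u v uv.
  apply: (@lshift_inj k m'); apply: (@perm_inj _ sigma); move: uv.
  set y := sigma _; set z := sigma _.
  by case: (ltngtP y z) => [/c_homo + yz|/c_homo + yz|/val_inj//]; rewrite yz ltnn.
rewrite (_ : contrs _ _ _ = 0) ?mulr0 //; apply: contra_neq_eq Uk => /contrs_neq0[V [dVU]].
rewrite size_map size_iota prod_ygen_homo // ybasE => Vm.
case: (V :|: U =P _) => [VU _|_]; last by rewrite mulr0n eqxx.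
have := congr1 (fun W : {set 'I_n} => #|W|) VU; rewrite cardsU (disjoint_setI0 dVU) cards0 subn0 Vm.
rewrite card_imset ?card_ord; first by rewrite addnC => /addIn.
move=> u v uv; apply/val_inj.
by case: (ltngtP u v) => [/c_homo|/c_homo|//]; rewrite uv ltnn.
Qed.

End RowDeterminant.

(** * Linear substitutions and divisibility by products of linear forms *)

Section Substitution.
Variables (F : finFieldType) (n : nat).
Local Notation P := {mpoly F[n]}.
Local Notation A := (extalg (mpoly n F) n).
Implicit Types (g : 'M[F]_n) (f : P) (a b : A) (s j : 'I_n).

Lemma mpoly_rmorph_eq (S : comNzRingType) (u v : {rmorphism P -> S}) :
  (forall c, u c%:MP = v c%:MP) -> (forall i, u 'X_i = v 'X_i) -> u =1 v.
Proof.
move=> uvC uvX f; rewrite (mpolyE f) !rmorph_sum; apply: eq_bigr => m _.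
rewrite -mul_mpolyC !rmorphM uvC mpolyXE_id !rmorph_prod; congr (_ * _).
by apply: eq_bigr => i _; rewrite !rmorphXn uvX.
Qed.

HB.instance Definition _ g := GRing.RMorphism.copy (actP g)
  (comp_mpoly [tuple \sum_i g i j *: 'X_i | j < n]).

Lemma actP_C g c : actP g c%:MP = c%:MP.
Proof. exact: comp_mpolyC. Qed.

Lemma actPZ g c f : actP g (c *: f) = c *: actP g f.
Proof. by rewrite -!mul_mpolyC rmorphM /= actP_C. Qed.

Lemma actPB g : {morph actP g : f h / f - h}.
Proof. exact: rmorphB. Qed.

Lemma actP_comp g h f : actP g (actP h f) = actP (g *m h) f.
Proof.
apply: (@mpoly_rmorph_eq _ (actP g \o actP h) (actP (g *m h))) => [c|j] /=.
  by rewrite !actP_C.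
rewrite !actP_X rmorph_sum /=.
under eq_bigr do rewrite actPZ actP_X scaler_sumr.
rewrite exchange_big; apply: eq_bigr => i _; rewrite mxE scaler_suml.
by apply: eq_bigr => k _; rewrite scalerA mulrC.
Qed.

Lemma actA_is_zmod_morphism g : {morph actA g : a b / a - b}.
Proof.
by move=> a b; rewrite actA_additive -scaleN1r actA_scale rmorphN1 scaleN1r.
Qed.

HB.instance Definition _ g := GRing.isZmodMorphism.Build A A (actA g) (actA_is_zmod_morphism g).


Lemma ext_semilinear_eq (c : P -> P) (u v : A -> A) :
    {morph u : a b / a + b} -> {morph v : a b / a + b} ->
    (forall f a, u (f *: a) = c f *: u a) -> (forall f a, v (f *: a) = c f *: v a) ->
    u 1 = v 1 -> (forall j a, u a = v a -> u (ygen P j * a) = v (ygen P j * a)) ->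
  u =1 v.
Proof.
move=> uD vD uZ vZ uv1 uvM a; elim/ext_ind: a => [a b Ha Hb|f a Ha||j a Ha] //.
- by rewrite uD vD Ha Hb.
- by rewrite uZ vZ Ha.
- exact: uvM.
Qed.

Lemma actA_comp g h a : actA g (actA h a) = actA (g *m h) a.
Proof.
apply: (@ext_semilinear_eq (actP (g *m h)) (actA g \o actA h) (actA (g *m h))).
- by move=> x y /=; rewrite (actA_additive h) (actA_additive g).
- exact: actA_additive.
- by move=> f x /=; rewrite (actA_scale h) (actA_scale g) actP_comp.
- exact: actA_scale.
- by rewrite /= (actA_1 h) (actA_1 g) (actA_1 (g *m h)).
move=> j x /= e; rewrite (actA_mul h) (actA_mul g) (actA_mul (g *m h)) [X in _ * X = _]e.
apply: (congr1 (fun b => b * _)); rewrite (actA_ygen h) (actA_ygen (g *m h)).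
rewrite /lin_ygen /ylin actA_sum.
under eq_bigr do rewrite actP_C actA_ygen /lin_ygen /ylin scaler_sumr.
rewrite exchange_big; apply: eq_bigr => i _; rewrite mxE rmorph_sum scaler_suml /=.
by apply: eq_bigr => k _; rewrite scalerA mpolyCM mulrC.
Qed.

(** Both sides are semilinear and obey the same antiderivation rule; the hypothesis equates their
    values on y_j, the right one being the contraction of g y_j by [k']. *)
Lemma actA_contr g (k k' : 'I_n -> P) a :
    (forall j, actP g (k j) = \sum_i (g i j)%:MP * k' i) ->
  actA g (contr k a) = contr k' (actA g a).
Proof.
move=> kk'; apply: (@ext_semilinear_eq (actP g) (actA g \o contr k) (contr k' \o actA g)).
- by move=> x y /=; rewrite contrD (actA_additive g).
- by move=> x y /=; rewrite (actA_additive g) contrD.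
- by move=> f x /=; rewrite contrZ (actA_scale g).
- by move=> f x /=; rewrite (actA_scale g) contrZ.
- by rewrite /= contr1 (actA_1 g) contr1 (raddf0 (actA g)).
move=> j x /= e.
have -> : actA g (ygen P j * x) = lin_ygen g j * actA g x.
  by rewrite (actA_mul g) (actA_ygen g).
rewrite /lin_ygen contr_ylinM contr_ygenM -kk' -e (raddfB (actA g)) /= (actA_scale g).
by rewrite (actA_mul g) (actA_ygen g).
Qed.

(* The substitution g on the coefficients only, the y_j being fixed. *)
Definition cact g a : A := [ffun U : {set 'I_n} => actP g (a U)].

Lemma cactE g a U : cact g a U = actP g (a U). Proof. exact: ffunE. Qed.

Lemma cact_mul g : {morph cact g : a b / a * b}.
Proof.
move=> a b; apply/ffunP => U; rewrite !ffunE rmorph_sum; apply: eq_bigr => T _.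
by rewrite !ffunE !rmorphM /= rmorph_sign.
Qed.

Lemma cact_comp g h a : cact g (cact h a) = cact (g *m h) a.
Proof. by apply/ffunP => U; rewrite !cactE actP_comp. Qed.

Lemma cact_contr g k a : cact g (contr k a) = contr (actP g \o k) (cact g a).
Proof.
apply/ffunP => U; rewrite cactE !contrE rmorph_sum; apply: eq_bigr => j _.
by rewrite !rmorphM /= rmorph_sign cactE.
Qed.

Lemma actA_cact g a :
    (forall U j, a U != 0 -> j \in U -> forall i, g i j = (i == j)%:R) ->
  actA g a = cact g a.
Proof.
move=> gE; rewrite /actA [RHS]ext_basisE; apply: eq_bigr => U _; rewrite cactE.
have [->|aU] := eqVneq (a U) 0; first by rewrite rmorph0 !scale0r.
rewrite -prod_ygen_enum; congr (_ *: _); apply: eq_big_seq => j.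
rewrite mem_enum => jU; rewrite /lin_ygen /ylin (bigD1 j) //= big1 => [|i ij].
  by rewrite (gE U) // eqxx scale1r addr0.
by rewrite (gE U) // (negPf ij) scale0r.
Qed.

(** Reads a polynomial as one in x_s, with coefficients kept in the full ring P: evaluation at x_s
    gives it back, evaluation at a linear form is a substitution. *)
Definition phi s : P -> {poly P} :=
  mmap (polyC \o mpolyC n (R := F)) (fun j => if j == s then 'X else ('X_j)%:P).

HB.instance Definition _ s := GRing.RMorphism.copy (phi s)
  (mmap (polyC \o mpolyC n (R := F)) (fun j => if j == s then 'X else ('X_j)%:P)).

Lemma phi_C s c : phi s c%:MP = (c%:MP)%:P.
Proof. exact: mmapC. Qed.

Lemma phi_X s j : phi s 'X_j = if j == s then 'X else ('X_j)%:P.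
Proof. by rewrite /phi mmapX mmap1U. Qed.

Lemma phiB s : {morph phi s : f h / f - h}.
Proof. exact: rmorphB. Qed.

Lemma phiD s : {morph phi s : f h / f + h}.
Proof. exact: rmorphD. Qed.

Lemma phiM s : {morph phi s : f h / f * h}.
Proof. exact: rmorphM. Qed.

Lemma phiZ s c f : phi s (c *: f) = (c%:MP)%:P * phi s f.
Proof. by rewrite -mul_mpolyC rmorphM /= phi_C. Qed.

Lemma horner_phi s g f : (forall i j, j != s -> g i j = (i == j)%:R) ->
  (phi s f).[actP g 'X_s] = actP g f.
Proof.
move=> gE; apply: (@mpoly_rmorph_eq _ (horner_eval (actP g 'X_s) \o phi s) (actP g))
  => [c|j] /=; rewrite /horner_eval.
  by rewrite phi_C hornerC actP_C.
rewrite phi_X; case: eqP => [->|/eqP js]; first by rewrite hornerX.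
rewrite hornerC actP_X (bigD1 j) //= gE // eqxx scale1r big1 ?addr0 // => i ij.
by rewrite gE // (negPf ij) scale0r.
Qed.

Lemma horner_phi_X s f : (phi s f).['X_s] = f.
Proof.
apply: (@mpoly_rmorph_eq _ (horner_eval 'X_s \o phi s) idfun) => [c|j] /=.
  by rewrite /horner_eval phi_C hornerC.
by rewrite /horner_eval phi_X; case: eqP => [->|_]; rewrite ?hornerX ?hornerC.
Qed.

Lemma phi_inj s : injective (phi s).
Proof. by move=> f h fh; rewrite -(horner_phi_X s f) fh horner_phi_X. Qed.

Lemma phi_const s g f : (forall j, g s j = 0) -> phi s (actP g f) = (actP g f)%:P.
Proof.
move=> g0; apply: (@mpoly_rmorph_eq _ (phi s \o actP g) (polyC \o actP g)) => [c|j] /=.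
  by rewrite actP_C phi_C.
rewrite actP_X !rmorph_sum; apply: eq_bigr => i _.
rewrite [LHS]phiZ phi_X -mul_mpolyC [RHS]rmorphM /=; case: eqP => [->|//].
by rewrite g0 mpolyC0 !mul0r.
Qed.

Definition lform (b : nat) (lam : {ffun {c : 'I_n | (c < b)%N} -> F}) : P :=
  \sum_c lam c *: 'X_(val c).

(** The polynomial v_s with a free number b of lower variables: b = tau(s) gives [vpoly], b = s the
    factors of the Moore determinant, and b = 0 the variable x_s. *)
Definition vprod (b : nat) s : P := \prod_lam (@lform b lam + 'X_s).

Lemma lform_inj (b : nat) : injective (@lform b).
Proof.
move=> lam mu lm; apply/ffunP => c.
have lformE nu : (@lform b nu)@_U_(val c) = nu c.
  rewrite /lform raddf_sum (bigD1 c) //= mcoeffZ mcoeffX eqxx mulr1.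
  rewrite big1 ?addr0 // => d dc; rewrite mcoeffZ mcoeffX.
  by rewrite eq_mnm1 (inj_eq val_inj) (negPf dc) mulr0.
by rewrite -(lformE lam) lm lformE.
Qed.

Lemma lformN (b : nat) (lam : {ffun {c : 'I_n | (c < b)%N} -> F}) : lform (- lam) = - lform lam.
Proof. by rewrite -sumrN; apply: eq_bigr => c _; rewrite ffunE scaleNr. Qed.

Lemma uniq_roots_factor (D : idomainType) (p : {poly D}) (rs : seq D) :
  uniq rs -> all (root p) rs -> exists q, p = q * \prod_(z <- rs) ('X - z%:P).
Proof.
elim: rs p => [|z rs IH] p /=; first by exists p; rewrite big_nil mulr1.
case/andP=> zrs urs /andP[/factor_theorem[q ->] /allP rsp].
have [|q' ->] := IH q urs; last by exists q'; rewrite big_cons mulrAC mulrA.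
apply/allP => w wrs; have := rsp _ wrs; rewrite rootM root_XsubC.
by case/orP=> // /eqP wz; rewrite -wz wrs in zrs.
Qed.

(** The forms lam.x are distinct roots in the domain P, so the product of the x_s - lam.x divides f;
    replacing lam by its opposite gives [vprod]. *)
Lemma vprod_dvd (b : nat) s f : (forall lam, (phi s f).[@lform b lam] = 0) ->
  exists h, f = vprod b s * h.
Proof.
move=> f0; have [||q fq] := @uniq_roots_factor _ (phi s f)
  [seq lform lam | lam <- enum {ffun {c : 'I_n | (c < b)%N} -> F}].
- by rewrite map_inj_uniq ?enum_uniq //; apply: lform_inj.
- by apply/allP => _ /mapP[lam _ ->]; apply/eqP/f0.
exists q.['X_s]; rewrite -{1}(horner_phi_X s f) fq hornerM mulrC; congr (_ * _).
have oppI : injective (fun lam : {ffun {c : 'I_n | (c < b)%N} -> F} => - lam).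
  exact: oppr_inj.
rewrite big_map big_enum horner_prod /vprod (reindex_inj oppI) /=.
by apply: eq_big => [lam|lam _]; rewrite ?inE // lformN hornerXsubC opprK addrC.
Qed.

Lemma card_ltn_sig (b : nat) : (b <= n)%N -> #|{: {c : 'I_n | (c < b)%N}}| = b.
Proof.
move=> bn; rewrite card_sig -sum1_card (eq_bigl (fun c : 'I_n => c < b)%N) //.
by rewrite (big_ord_narrow bn) sum1_card card_ord.
Qed.

Lemma phi_vprod (b : nat) s : (b <= s)%N ->
  phi s (vprod b s) = \prod_lam ('X - (- @lform b lam)%:P).
Proof.
move=> bs; rewrite rmorph_prod; apply: eq_bigr => lam _; rewrite rmorphD /= phi_X eqxx.
rewrite polyCN opprK addrC; congr (_ + _); rewrite /lform !rmorph_sum.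
apply: eq_bigr => c _; rewrite [LHS]phiZ phi_X -mul_mpolyC [RHS]rmorphM /=.
by case: eqP => // cs; have /= := valP c; rewrite [\val c]cs ltnNge bs.
Qed.

Lemma size_phi_vprod (b : nat) s : (b <= s)%N -> size (phi s (vprod b s)) = (#|F| ^ b).+1.
Proof.
move=> bs; rewrite phi_vprod // -(big_enum _ _ predT) size_prod_XsubC -cardE.
by rewrite card_ffun card_ltn_sig // (leq_trans bs) // ltnW.
Qed.

Lemma actP_vprod g (b : nat) s : (forall i j, (j < b)%N || (j == s) -> g i j = (i == j)%:R) ->
  actP g (vprod b s) = vprod b s.
Proof.
move=> gE; have gX j : (j < b)%N || (j == s) -> actP g 'X_j = 'X_j.
  move=> jb; rewrite actP_X (bigD1 j) //= gE // eqxx scale1r big1 ?addr0 // => i ij.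
  by rewrite gE // (negPf ij) scale0r.
rewrite rmorph_prod; apply: eq_bigr => lam _; rewrite rmorphD /= gX ?eqxx ?orbT //.
rewrite rmorph_sum; congr (_ + _); apply: eq_bigr => c _ /=.
by rewrite actPZ gX // (valP c).
Qed.

Lemma size_mul_succ (D : idomainType) (p q : {poly D}) m :
  size p = m.+1 -> q != 0 -> size (p * q) = (m + size q)%N.
Proof. by move=> sp q0; rewrite size_mul ?sp // -size_poly_gt0 sp. Qed.

(** If h is nonzero, f has size q^b + size h > q^b, so the bound in force is [d.+1]. The second
    argument of the maximum leaves room for corrections of degree below q^b in x_s. *)
Lemma size_phi_quot (b : nat) s f h d : (b <= s)%N -> f = vprod b s * h ->
  (size (phi s f) <= maxn d.+1 (#|F| ^ b))%N -> (size (phi s h) <= d)%N.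
Proof.
move=> bs -> ; have sv := size_phi_vprod bs.
have [->|h0] := eqVneq h 0; first by rewrite rmorph0 size_poly0.
have ph0 : phi s h != 0 by rewrite -(rmorph0 (phi s)) (inj_eq (@phi_inj s)).
have pv0 : phi s (vprod b s) != 0 by rewrite -size_poly_gt0 sv.
have -> : phi s (vprod b s * h) = phi s (vprod b s) * phi s h by exact: rmorphM.
rewrite (@size_mul_succ {mpoly F[n]} _ _ _ sv ph0).
rewrite -size_poly_gt0 in ph0.
have : (0 < #|F| ^ b)%N by rewrite expn_gt0 (ltnW (finNzRing_gt1 F)).
move: (expn _ _) (size _) ph0 => q m m_gt0 q_gt0.
rewrite leq_max; lia.
Qed.

Lemma vprod_neq0 (b : nat) s : (b <= s)%N -> vprod b s != 0.
Proof.
by move=> bs; apply/eqP => v0; have := size_phi_vprod bs; rewrite v0 rmorph0 size_poly0.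
Qed.

End Substitution.

(** * Duality for families of contractions *)

Section Koszul.
Variables (R : comNzRingType) (n : nat) (kap : 'I_n -> 'I_n -> R).
Local Notation A := (extalg R n).
Implicit Types (B E S T U V W : {set 'I_n}) (a b : A).

Lemma contrs_perm (s t : seq 'I_n) : perm_eq s t ->
  exists k, forall a, contrs (map kap s) a = (-1) ^+ k *: contrs (map kap t) a.
Proof.
elim: s t => [|j s IH] t.
  by rewrite perm_sym => /perm_nilP->; exists 0%N => a; rewrite scale1r.
move=> pst; have jt : j \in t by rewrite -(perm_mem pst) mem_head.
case/splitPr: jt pst => t1 t2; rewrite -[j :: t2]cat1s perm_sym perm_catCA /= perm_cons perm_sym.
case/IH=> k kE; exists (size t1 + k)%N => a.
rewrite [LHS]kE !map_cat !contrs_cat /= contrs_contr linearZ /= size_map.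
by rewrite scalerA -exprD addnC.
Qed.

Definition ctr E a : A := contrs (map kap (enum E)) a.

HB.instance Definition _ E := GRing.Linear.copy (ctr E) (contrs (map kap (enum E))).


Lemma contrs_ctr (s : seq 'I_n) E : uniq s -> s =i E ->
  exists k, forall a, contrs (map kap s) a = (-1) ^+ k *: ctr E a.
Proof.
move=> us sE; apply: contrs_perm; apply: uniq_perm => //; first exact: enum_uniq.
by move=> j; rewrite mem_enum sE.
Qed.

Lemma contr_ctr_mem E j a : j \in E -> contr (kap j) (ctr E a) = 0.
Proof.
rewrite -mem_enum /ctr => /path.splitPr[s1 s2].
by rewrite map_cat contrs_cat /=; apply/contrs_mem0/contr_sqr0.
Qed.

Lemma ctr_ctr E T : [disjoint E & T] ->
  exists k, forall a, ctr E (ctr T a) = (-1) ^+ k *: ctr (T :|: E) a.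
Proof.
move=> dET; have [||k kE] := @contrs_ctr (enum T ++ enum E) (T :|: E).
- rewrite cat_uniq !enum_uniq andbT; apply/hasPn => j /=; rewrite !mem_enum => jE.
  by rewrite (disjointFr dET jE).
- by move=> j; rewrite mem_cat !mem_enum inE.
by exists k => a; rewrite -kE map_cat contrs_cat.
Qed.

Lemma ctr_ctr0 E T a : ~~ [disjoint E & T] -> ctr E (ctr T a) = 0.
Proof.
rewrite -setI_eq0 => /set0Pn[j]; rewrite inE => /andP[jE jT].
move: (jE); rewrite -mem_enum {1}/ctr => /path.splitPr[s1 s2].
rewrite map_cat contrs_cat /= contrs_mem0 ?linear0 //; exact: contr_ctr_mem.
Qed.

Lemma ctr_neq0 E a U : ctr E a U != 0 ->
  exists V : {set 'I_n}, [/\ [disjoint V & U], #|V| = #|E| & a (V :|: U) != 0].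
Proof. by move/contrs_neq0; rewrite size_map -cardE. Qed.

Lemma contr_delta_ybas (j : 'I_n) W : j \notin W ->
  exists k, contr (delta j) (ybas R (j |: W)) = (-1) ^+ k *: ybas R W :> A.
Proof.
move=> jW; exists (ext_inv [set j] W).
rewrite ygenM_ybas_sign // contrZ contr_ygenM /delta eqxx scale1r.
suff -> : contr (fun i => (i == j)%:R) (ybas R W) = 0 by rewrite mulr0 subr0.
apply/ffunP => U; rewrite contr_delta ybasE [RHS]ffunE; case: ifP => // _.
by case: eqP jW => [<-|_ _]; rewrite ?setU11 // mulr0.
Qed.

(** The elements of U are removed one at a time by [contr (delta j)], which commutes with the
    iterated contraction up to sign. *)
Lemma contrs_ybasU (ks : seq ('I_n -> R)) W U : [disjoint W & U] ->
  exists k, contrs ks (ybas R (W :|: U)) U = (-1) ^+ k * contrs ks (ybas R W) set0.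
Proof.
have [m] := ubnP #|U|; elim: m U => // m IHm U Um dWU.
have [->|[j jU]] := set_0Vmem U; first by exists 0%N; rewrite setU0 mul1r.
have jU' : j \notin U :\ j by rewrite !inE eqxx.
have jW : j \notin W by rewrite (disjointFl dWU jU).
have dWU' : [disjoint W & U :\ j].
  by apply: disjointWr dWU; apply: subD1set.
have U'm : (#|U :\ j| < m)%N by move: Um; rewrite (cardsD1 j U) jU.
have [k kE] := IHm _ U'm dWU'.
have jWU : j \notin W :|: (U :\ j) by rewrite inE negb_or jW.
have [k' k'E] := contr_delta_ybas jWU.
have e : contr (delta j) (contrs ks (ybas R (W :|: U))) (U :\ j) =
   (-1) ^+ ext_inv [set j] (U :\ j) * contrs ks (ybas R (W :|: U)) U.
  by rewrite contr_delta (negPf jU') setD1K.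
exists (ext_inv [set j] (U :\ j) + (size ks + (k' + k)))%N.
rewrite -[LHS]mul1r -[X in X * _](sqrr_sign R (ext_inv [set j] (U :\ j))) expr2.
rewrite -mulrA -e exprD -mulrA; congr (_ * _).
have -> : W :|: U = j |: (W :|: (U :\ j)) by rewrite setUCA setD1K.
have -> : contr (delta j) (contrs ks (ybas R (j |: (W :|: U :\ j)))) =
   (-1) ^+ size ks *: contrs ks (contr (delta j) (ybas R (j |: (W :|: U :\ j)))).
  by rewrite contrs_contr scalerA -expr2 sqrr_sign scale1r.
by rewrite k'E linearZ /= !ext_scaleE kE !exprD !mulrA.
Qed.

(* For kap the Frobenius contractions and B = {1, ..., b}, kform B S is N_{b,S}
   up to sign; qcoef B is the dual system, and topc B the Moore determinant. *)
Definition kform B S : A := ctr (B :\: S) (ybas R (B :|: S)).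
Definition qcoef B S a : R := ctr (S :&: B) a (S :\: B).
Definition topc B : R := ctr B (ybas R B) set0.

Lemma qcoef_sum B S (J : finType) (c : J -> R) (u : J -> A) :
  qcoef B S (\sum_v c v *: u v) = \sum_v c v * qcoef B S (u v).
Proof.
rewrite /qcoef linear_sum sum_ffunE; apply: eq_bigr => v _.
by rewrite linearZ ext_scaleE.
Qed.

Lemma qcoef0 B S : qcoef B S 0 = 0.
Proof. by rewrite /qcoef linear0 ffunE. Qed.

Lemma qcoefB B S a b : qcoef B S (a - b) = qcoef B S a - qcoef B S b.
Proof. by rewrite /qcoef linearB ext_addE ext_oppE. Qed.

(** The contractions in use are those of E = (B minus S) and (T in B). A repetition gives 0.
    Otherwise a nonzero coefficient makes the removed set V contain B, while [#|V| = #|E|] and E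
    lies in B; so V = E = B, which forces T = S inside B and outside B. *)
Lemma qcoef_kform_neq B S T : T != S -> qcoef B T (kform B S) = 0.
Proof.
move=> TS; rewrite /qcoef /kform.
case: (boolP [disjoint T :&: B & B :\: S]) => dTS; last by rewrite ctr_ctr0 // ffunE.
have [k ->] := ctr_ctr dTS; rewrite ext_scaleE.
apply: contraNeq TS => nz.
have {nz} : ctr (B :\: S :|: T :&: B) (ybas R (B :|: S)) (T :\: B) != 0.
  by apply: contraNneq nz => ->; rewrite mulr0.
case/ctr_neq0=> V [dV cV]; rewrite ybasE.
case: (V :|: T :\: B =P _) => [VT _|_]; last by rewrite mulr0n eqxx.
have BV : B \subset V.
  apply/subsetP => j jB; have : j \in V :|: T :\: B by rewrite VT inE jB.
  by rewrite !inE jB orbF.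
have EB : B :\: S :|: T :&: B \subset B by rewrite subUset subsetDl subsetIr.
have VB : V = B.
  apply/esym/eqP; rewrite eqEcard BV /= cV; exact: subset_leq_card.
have EeB : B :\: S :|: T :&: B = B by apply/eqP; rewrite eqEcard EB -cV VB leqnn.
apply/eqP/setP => j; case: (boolP (j \in B)) => jB.
  have := jB; rewrite -{1}EeB !inE jB !andbT.
  case: (boolP (j \in S)) => /= jS; first by move=> ->.
  have jBS : j \in B :\: S by rewrite !inE jB jS.
  by move: (disjointFl dTS jBS); rewrite inE jB andbT => ->.
by have /setP/(_ j) := VT; rewrite VB !inE (negPf jB).
Qed.

Lemma qcoef_kform B S : exists k, qcoef B S (kform B S) = (-1) ^+ k * topc B.
Proof.
rewrite /qcoef /kform /topc.
have dS : [disjoint S :&: B & B :\: S].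
  by rewrite -setI_eq0; apply/eqP/setP => j; rewrite !inE; case: (j \in S); rewrite ?andbF.
have [k ->] := ctr_ctr dS; rewrite ext_scaleE.
have -> : B :\: S :|: S :&: B = B.
  by apply/setP => j; rewrite !inE; case: (j \in S); rewrite ?andbF ?orbF.
have -> : B :|: S = B :|: (S :\: B).
  by apply/setP => j; rewrite !inE; case: (j \in B).
have [|k' k'E] := @contrs_ybasU (map kap (enum B)) B (S :\: B).
  by rewrite -setI_eq0; apply/eqP/setP => j; rewrite !inE; case: (j \in B).
by exists (k + k')%N; rewrite exprD -mulrA -k'E.
Qed.

Lemma qcoef_kform_sum B (c : {set 'I_n} -> R) S :
  exists k, qcoef B S (\sum_T c T *: kform B T) = c S * ((-1) ^+ k * topc B).
Proof.
have [k kE] := qcoef_kform B S; exists k.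
rewrite qcoef_sum (bigD1 S) //= kE big1 ?addr0 // => T TS.
by rewrite qcoef_kform_neq ?mulr0 // eq_sym.
Qed.

Lemma contr_mul_const k a b : contr k b = 0 -> contr k (a * b) = contr k a * b.
Proof.
move=> kb; elim/ext_ind: a => [a c Ha Hc|f a Ha||j a Ha].
- by rewrite mulrDl !contrD mulrDl Ha Hc.
- by rewrite -ext_scaleAl !contrZ -ext_scaleAl Ha.
- by rewrite mul1r contr1 mul0r.
by rewrite -mulrA !contr_ygenM Ha mulrBl -ext_scaleAl mulrA.
Qed.

Lemma ctr_mul_const E a b : (forall j, j \in E -> contr (kap j) b = 0) ->
  ctr E (a * b) = ctr E a * b.
Proof.
move=> Eb; have {}Eb : forall j, j \in enum E -> contr (kap j) b = 0.
  by move=> j; rewrite mem_enum; apply: Eb.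
rewrite /ctr; elim: (enum E) a Eb => //= j s IH a Eb.
rewrite contr_mul_const ?Eb ?mem_head // IH // => i si.
by apply: Eb; rewrite inE si orbT.
Qed.

(** When the pairing of [nu] with each [kap e] is 0, the antiderivation rule makes each contraction
    anticommute with multiplication by [ylin nu]. *)
Lemma contrs_ylin_eq0 (s : seq 'I_n) (nu : 'I_n -> R) a :
    (forall e, \sum_i nu i * kap e i = 0) -> ylin nu * a = 0 ->
  ylin nu * contrs (map kap s) a = 0.
Proof.
move=> nu0; elim: s a => //= e s IH a a0; apply: IH.
have := contr_ylinM (kap e) nu a.
by rewrite a0 linear0 nu0 scale0r sub0r => /esym/eqP; rewrite oppr_eq0 => /eqP.
Qed.

(** In the coefficient at [c |: U] of the product only y_c contributes, as [nu] vanishes on U. *)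
Lemma ylin_mul_coef0 (nu : 'I_n -> R) c a U : nu c = 1 -> c \notin U ->
  (forall i, i \in U -> nu i = 0) -> ylin nu * a = 0 -> a U = 0.
Proof.
move=> nuc cU nuU /(congr1 (fun b : A => b (c |: U))).
rewrite /ylin mulr_suml sum_ffunE [RHS]ffunE (bigD1 c) //= big1 => [|i ic].
  rewrite addr0 nuc scale1r ygenME setU11 setU1K //.
  move=> /(congr1 (fun x => (-1) ^+ ext_inv [set c] U * x)).
  by rewrite mulrA -expr2 sqrr_sign mul1r mulr0.
rewrite -ext_scaleAl ext_scaleE ygenME !inE (negPf ic) /=.
by case: ifP => [/nuU->|_]; rewrite ?mul0r ?mulr0.
Qed.

Lemma ybas_mul_eq0 B a : (forall U, [disjoint U & B] -> a U = 0) -> ybas R B * a = 0.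
Proof.
move=> a0; apply/ffunP => U; rewrite ffunE [RHS]ffunE big1 // => T TU.
rewrite ybasE; case: eqP => [->|_]; last by rewrite mulr0 mul0r.
rewrite a0 ?mulr0 // -setI_eq0; apply/eqP/setP => j; rewrite !inE.
by case: (j \in B); rewrite ?andbF.
Qed.

Lemma ctr_top B : ctr B (ybas R B) = (topc B)%:A.
Proof.
apply/ffunP => U; rewrite ext_scaleE ffunE; have [->|U0] := eqVneq U set0.
  by rewrite mulr1.
rewrite mulr0; apply: contraNeq U0 => /ctr_neq0[V [dVU cV]].
rewrite ybasE; case: (V :|: U =P _) => [VU _|_]; last by rewrite mulr0n eqxx.
have VB : V = B by apply/eqP; rewrite eqEcard cV leqnn andbT -VU subsetUl.
have UB : U \subset V by rewrite VB -VU subsetUr.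
by rewrite -subset0 -(disjoint_setI0 dVU) subsetI UB subxx.
Qed.

End Koszul.

(** A maximal set of contractions not killing [a] takes the place of a change of basis over the
    field of fractions. *)
Lemma qcoef_uniq (R : idomainType) n (kap : 'I_n -> 'I_n -> R) B (a : extalg R n) :
  topc kap B != 0 -> (forall S, qcoef kap B S a = 0) -> a = 0.
Proof.
move=> L0 qa; apply/eqP/negPn/negP => a0.
have E0 : (set0 \subset B) && (ctr kap set0 a != 0) by rewrite sub0set /ctr enum_set0.
case: (@arg_maxnP _ set0 (fun E => (E \subset B) && (ctr kap E a != 0)) (fun E => #|E|) E0)
  => E /andP[EB Ea] Emax.
set c := ctr kap E a in Ea; case/negP: Ea; apply/eqP.
(* By maximality of E, all contractions kill c; hence contracting y_B c, which
   is 0, by all of them gives topc B * c. *)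
have kc j : j \in B -> contr (kap j) c = 0.
  move=> jB; case: (boolP (j \in E)) => jE; first exact: contr_ctr_mem.
  apply/eqP/negPn/negP => nz.
  have dj : [disjoint [set j] & E] by rewrite disjoints1.
  have [k kE] := ctr_ctr kap dj.
  have := Emax (E :|: [set j]); rewrite subUset EB sub1set jB /=.
  rewrite setUC cardsU1 jE add1n ltnn => /(_ _)/negP; case=> //.
  apply: contraNneq nz => e; have := kE a; rewrite setUC e scaler0.
  by rewrite {1}/ctr enum_set1 /= => ->.
(* The dual coefficient at [E :|: U] is the coefficient of [c] at U, because E lies in B and U
   avoids it. *)
have c0 (U : {set 'I_n}) : [disjoint U & B] -> c U = 0.
  move=> dUB; have := qa (E :|: U); rewrite /qcoef.
  have -> : (E :|: U) :&: B = E by rewrite setIUl (setIidPl EB) (disjoint_setI0 dUB) setU0.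
  have -> // : (E :|: U) :\: B = U.
  rewrite setDUl (eqP (_ : E :\: B == set0)) ?setD_eq0 // set0U.
  by apply/setDidPl.
have := ctr_mul_const (ybas R B) kc; rewrite ybas_mul_eq0 // linear0 ctr_top.
rewrite -scalerAl mul1r => /esym Lc; apply/ffunP => U.
have /ffunP/(_ U)/eqP := Lc; rewrite ext_scaleE !ffunE mulf_eq0 (negPf L0).
by move/eqP.
Qed.

Lemma kform_free (R : idomainType) n (kap : 'I_n -> 'I_n -> R) B
    (c : {set 'I_n} -> R) :
  topc kap B != 0 -> \sum_T c T *: kform kap B T = 0 -> forall S, c S = 0.
Proof.
move=> L0 e S; have [k] := qcoef_kform_sum kap B c S.
by rewrite e qcoef0 => /esym/eqP; rewrite !mulf_eq0 signr_eq0 (negPf L0) !orbF => /eqP.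
Qed.

(** The pairing between the two systems is diagonal with entries plus or minus [topc], so the
    quotients h, up to sign, are the only candidates; [qcoef_uniq] shows that they work. *)
Lemma kform_decomp (R : idomainType) n (kap : 'I_n -> 'I_n -> R) B (a : extalg R n) :
    topc kap B != 0 -> (forall S, exists h, qcoef kap B S a = topc kap B * h) ->
  exists c : {set 'I_n} -> R, a = \sum_S c S *: kform kap B S.
Proof.
move=> L0 /fin_all_exists[h hE].
have /fin_all_exists[k kE] : forall S, exists k, qcoef kap B S (kform kap B S) =
    (-1) ^+ k * topc kap B by move=> S; apply: qcoef_kform.
exists (fun S => (-1) ^+ k S * h S); apply/eqP; rewrite -subr_eq0; apply/eqP.
apply: (qcoef_uniq L0) => S; rewrite qcoefB hE qcoef_sum (bigD1 S) //= big1 => [|T TS].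
  rewrite addr0 kE mulrACA -expr2 sqrr_sign mul1r mulrC.
  exact: subrr.
by rewrite qcoef_kform_neq ?mulr0 // eq_sym.
Qed.

(** * Contractions along Frobenius powers *)

Section Frobenius.
Variables (F : finFieldType) (n : nat).
Local Notation P := {mpoly F[n]}.
Local Notation A := (extalg (mpoly n F) n).
Local Notation q := #|F|.
Implicit Types (g : 'M[F]_n) (f : P) (a : A) (s j : 'I_n) (S U : {set 'I_n}).

Lemma mpoly_pchar_nat e : [pchar P].-nat (q ^ e)%N.
Proof.
have [p p_prime pF] := finPcharP F.
have pP : p \in [pchar P].
  by rewrite inE p_prime -mpolyC_nat (eqP (andP pF).2) mpolyC0 eqxx.
rewrite (eq_pnat _ (pcharf_eq pP)) pnatX.
by have := abelem_pgroup (fin_ring_pchar_abelem pF); rewrite /pgroup cardsT => ->.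
Qed.

Lemma expf_cardX (c : F) e : c ^+ (q ^ e)%N = c.
Proof. by elim: e => [|e IH]; rewrite ?expr1 // expnSr exprM IH expf_card. Qed.

(** Exponents share the index type of the variables: the excluded exponents s_i - 1 are then the
    0-based elements of S, and [B :\: S] is a set of exponents. *)
Definition frob (e j : 'I_n) : P := 'X_j ^+ (q ^ e).

Lemma actP_frob g e j : actP g (frob e j) = \sum_i (g i j)%:MP * frob e i.
Proof.
rewrite rmorphXn /= actP_X.
elim/big_rec2: _ => [|i y x _ <-].
  by rewrite expr0n expn_eq0 gtn_eqF // (ltnW (finNzRing_gt1 F)).
by rewrite exprDn_pchar ?mpoly_pchar_nat // exprZn expf_cardX mul_mpolyC.
Qed.

Lemma actA_frob g e a : actA g (contr (frob e) a) = contr (frob e) (actA g a).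
Proof. by apply: actA_contr => j; apply: actP_frob. Qed.

Lemma actA_ctr g (E : {set 'I_n}) a : actA g (ctr frob E a) = ctr frob E (actA g a).
Proof.
rewrite /ctr; elim: (enum E) a => //= e s IH a.
by rewrite IH; congr (contrs _ _); apply: actA_frob.
Qed.

Definition below (b : nat) : {set 'I_n} := [set c : 'I_n | (c < b)%N].

Lemma Nexps_enum b S : (b <= n)%N -> Nexps b S = [seq val c | c <- enum (below b :\: S)].
Proof.
move=> bn; apply: (irr_sorted_eq ltn_trans ltnn).
- by apply: (sorted_filter ltn_trans); apply: iota_ltn_sorted.
- by rewrite sorted_map; apply: sorted_enum.
move=> e; rewrite mem_filter mem_iota add0n leq0n /=; apply/andP/mapP => [[eS eb]|[c]].
  have en : (e < n)%N by apply: leq_trans bn.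
  exists (Ordinal en) => //; rewrite mem_enum !inE eb andbT.
  by apply: contra eS => eS; apply/mapP; exists (Ordinal en); rewrite ?mem_enum.
rewrite mem_enum !inE => /andP[cS cb] ->; split=> //.
by apply: contra cS => /mapP[d]; rewrite mem_enum => dS /val_inj->.
Qed.

(** An instance of [rowdet_contrs]: the columns form [below b :|: S] and the exponents
    [below b :\: S], whose cardinals differ by the number [#|S|] of rows of y. *)
Lemma Nform_kform b S : (b <= n)%N -> S != set0 ->
  exists k, Nform F q b S = (-1) ^+ k *: kform frob (below b) S.
Proof.
move=> bn S0; rewrite /Nform (negPf S0).
have NcolsE : Ncols b S = below b :|: S by apply/setP => c; rewrite !inE.
have sz : #|Ncols b S| = (#|S| + size (Nexps b S))%N.
  rewrite Nexps_enum // size_map -cardE NcolsE setUC -cardsUI.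
  rewrite (_ : S :&: _ = set0) ?cards0 ?addn0; last first.
    by apply/setP => c; rewrite !inE; case: (c \in S).
  by apply: eq_card => c; rewrite !inE; case: (c \in S).
pose x i : 'I_n -> P := fun j => 'X_j ^+ (q ^ nth 0%N (Nexps b S) i).
have homo : {homo (@enum_val _ (mem (Ncols b S))) : u v / (u < v)%N}.
  move=> u v uv; have j0 := enum_val u; rewrite !(enum_val_nth j0).
  by apply: (sorted_ltn_nth (@ltI_trans n) j0 (sorted_enum _)); rewrite ?inE -?cardE.
have := rowdet_contrs x sz homo; set N1 := \sum_(_ | _) _; set N2 := \sum_(_ | _) _ => N1E.
have -> : N2 = N1.
  apply: eq_bigr => sigma _; congr (_ * _); apply: eq_bigr => u _.
  by rewrite mxE.
rewrite N1E; exists (#|S| * size (Nexps b S))%N; congr (_ *: _).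
rewrite /kform -NcolsE; have -> : [set enum_val u | u in 'I_#|Ncols b S|] = Ncols b S.
  apply/setP => c; apply/imsetP/idP => [[u _ ->]|cN]; first exact: enum_valP.
  by exists (enum_rank_in cN c) => //; rewrite enum_rankK_in.
congr (contrs _ _); rewrite Nexps_enum //.
rewrite /x Nexps_enum // size_map.
apply: (@eq_from_nth _ (fun _ => 0)) => [|i]; rewrite !size_map size_iota // => ib.
have [e0 _] : exists e : 'I_n, true.
  by move: ib; rewrite -cardE => /(leq_ltn_trans (leq0n _))/card_gt0P[e _]; exists e.
rewrite (nth_map 0%N) ?size_iota // nth_iota // (nth_map e0) //.
by rewrite add0n (nth_map e0).
Qed.

End Frobenius.

(** * Moore determinants *)

Section Moore.
Variables (F : finFieldType) (n : nat).
Local Notation P := {mpoly F[n]}.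
Local Notation A := (extalg (mpoly n F) n).
Local Notation q := #|F|.
Local Notation frob := (@frob F n).
Local Notation below := (@below n).
Implicit Types (g : 'M[F]_n) (f : P) (a : A) (s j : 'I_n) (S U W : {set 'I_n}).

Lemma actA_coef0 g a : actA g a set0 = actP g (a set0).
Proof.
apply: (@ext_scalar_inj P n).
(* Constant coefficients are embedded as scalars of the algebra, since the principle compares maps
   with values there. *)
apply: (@ext_semilinear_eq _ _ (actP g) (fun b => (actA g b set0)%:A)
          (fun b => (actP g (b set0))%:A)).
- by move=> x y; rewrite (actA_additive g x y) (ext_addE (actA g x)) scalerDl.
- by move=> x y; rewrite (ext_addE x) rmorphD scalerDl.
- by move=> f x; rewrite (actA_scale g f x) (ext_scaleE _ (actA g x)) scalerA.
- by move=> f x; rewrite (ext_scaleE f x) rmorphM scalerA.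
- by rewrite (actA_1 g) (ext_1E P set0) eqxx (rmorph1 (actP g)).
move=> j x _; rewrite (actA_mul g) (actA_ygen g) (ygenME j x set0) inE (rmorph0 (actP g)) scale0r.
rewrite /lin_ygen /ylin mulr_suml sum_ffunE big1 ?scale0r // => i _.
by rewrite -ext_scaleAl (ext_scaleE _ (ygen P i * actA g x)) ygenME inE mulr0.
Qed.

Lemma lin_ygenM_ybas g j (s : seq 'I_n) : g j j = 1 ->
    (forall i, i != j -> g i j != 0 -> i \in s) ->
  (\prod_(i <- s) ygen P i) * lin_ygen g j = (\prod_(i <- s) ygen P i) * ygen P j.
Proof.
move=> gj gs; rewrite /lin_ygen /ylin (bigD1 j) //= gj scale1r mulrDr mulr_sumr.
rewrite [X in _ + X]big1 ?addr0 // => i ij.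
have [->|gij] := eqVneq (g i j) 0; first by rewrite mpolyC0 scale0r mulr0.
by rewrite -ext_scaleAr prod_ygenM_mem ?scaler0 // gs.
Qed.

(** Here g y_j is y_j plus terms y_i with i in W and i < j. In the increasing product such a y_i
    already stands to the left, so these terms vanish; the induction runs over prefixes of the
    product. *)
Lemma actA_ybas_fix g W : (forall j, j \in W -> g j j = 1) ->
    (forall i j, j \in W -> i != j -> g i j != 0 -> (i \in W) && (i < j)%N) ->
  actA g (ybas P W) = ybas P W.
Proof.
move=> g1 gW; rewrite (actA_ybas g) -prod_ygen_enum.
suff prefix (s t : seq 'I_n) : s ++ t = enum W ->
    \prod_(j <- s) lin_ygen g j = \prod_(j <- s) ygen P j.
  by apply: (prefix _ [::]); rewrite cats0.
elim/last_ind: s t => [|s j IH] t st; first by rewrite !big_nil.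
rewrite cat_rcons in st; rewrite -!cats1 !big_cat !big_seq1 (IH (j :: t)) //.
have jW : j \in W by rewrite -mem_enum -st mem_cat mem_head orbT.
apply: lin_ygenM_ybas => [|i ij gij]; first exact: g1.
have /andP[iW lt_ij] := gW i j jW ij gij.
have := sorted_enum W; rewrite -st => sW.
move: iW; rewrite -mem_enum -st mem_cat inE (negPf ij) /= => /orP[//|it].
move: sW; rewrite (sorted_pairwise (@ltI_trans n)) pairwise_cat /= => /and3P[_ _ /andP[/allP jt _]].
by have := jt _ it; rewrite /ltI ltnNge (ltnW lt_ij).
Qed.

(** The substitution x_s := v.x, y_s := v.y, the other generators being fixed; for [v s = 0] it is
    the reduction modulo x_s - v.x. *)
Definition colmx s (v : 'I_n -> F) : 'M[F]_n :=
  \matrix_(i, j) if j == s then v i else (i == j)%:R.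

Definition lvec (b : nat) (lam : {ffun {c : 'I_n | (c < b)%N} -> F}) (i : 'I_n) : F :=
  if insub i is Some c then lam c else 0.

Lemma lformE (b : nat) (lam : {ffun {c : 'I_n | (c < b)%N} -> F}) :
  lform lam = \sum_i lvec lam i *: 'X_i.
Proof.
rewrite (bigID (fun i : 'I_n => i < b)%N) /= [X in _ + X]big1 ?addr0 => [|i ib].
  rewrite (reindex_omap (val : {c : 'I_n | (c < b)%N} -> 'I_n) insub) /=.
    apply: eq_big => [[c cb]|[c cb] _] /=; first by rewrite insubT cb eqxx.
    by rewrite /lvec insubT.
  by move=> i ib; rewrite insubT.
by rewrite /lvec insubN // scale0r.
Qed.

Lemma lvec_ge (b : nat) (lam : {ffun {c : 'I_n | (c < b)%N} -> F}) (i : 'I_n) :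
  lvec lam i != 0 -> (i < b)%N.
Proof. by apply: contra_neqT => ib; rewrite /lvec insubN. Qed.

Lemma actP_colmx_X s (b : nat) (lam : {ffun {c : 'I_n | (c < b)%N} -> F}) :
  actP (colmx s (lvec lam)) 'X_s = lform lam.
Proof. by rewrite actP_X lformE; apply: eq_bigr => i _; rewrite mxE eqxx. Qed.

Lemma horner_phi_lform s (b : nat) (lam : {ffun {c : 'I_n | (c < b)%N} -> F}) f :
  (phi s f).[lform lam] = actP (colmx s (lvec lam)) f.
Proof.
by rewrite -(actP_colmx_X s) horner_phi // => i j /negPf js; rewrite mxE js.
Qed.

Lemma actA_colmx_ybas s v W : s \notin W -> actA (colmx s v) (ybas P W) = ybas P W.
Proof.
move=> sW; apply: actA_ybas_fix => [j jW|i j jW ij].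
  by rewrite mxE; case: (j =P s) => [js|_]; rewrite ?eqxx // -js jW in sW *.
by rewrite mxE; case: (j =P s) => [js|_]; rewrite ?(negPf ij) ?eqxx // -js jW in sW *.
Qed.

(** Putting x_s and y_s to 0 fixes the monomial on [below b] and commutes with the contractions, so
    it fixes the determinant. *)
Lemma topc_const s (b : nat) : (b <= s)%N ->
  phi s (topc frob (below b)) = (topc frob (below b))%:P.
Proof.
move=> bs; have <- : actP (colmx s (fun _ => 0)) (topc frob (below b)) = topc frob (below b).
  rewrite /topc -actA_coef0 actA_ctr actA_colmx_ybas //.
  by rewrite inE -leqNgt.
by apply: phi_const => j; rewrite mxE; case: eqP => // /eqP; rewrite eq_sym => /negPf->.
Qed.

(* The coefficients of the y_U have degree less than d in x_s, and do not involve
   x_s at all for s \in U. *)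
Definition dbound s (d : nat) a :=
  forall U, (size (phi s (a U)) <= (if s \in U then 1 else d))%N.

Lemma size_phi_sum s (J : finType) (Q : pred J) (c : J -> P) (d : nat) :
  (forall t, Q t -> (size (phi s (c t)) <= d)%N) -> (size (phi s (\sum_(t | Q t) c t)%R) <= d)%N.
Proof.
move=> cd; rewrite rmorph_sum; apply: leq_trans (size_sum _ _ _) _.
by apply/bigmax_leqP.
Qed.

Lemma size_phi_signM s k f : size (phi s ((-1) ^+ k * f)) = size (phi s f).
Proof.
rewrite -signr_odd mulr_sign; case: ifP => [_|//].
by rewrite (raddfN (phi s)) size_polyN.
Qed.

Lemma phi_frob s (e j : 'I_n) :
  phi s (frob e j) = (if j == s then 'X else ('X_j)%:P) ^+ (q ^ e).
Proof. by rewrite /frob rmorphXn /= phi_X. Qed.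

(** The only term that brings in x_s, namely x_s^(q^e), multiplies a coefficient at [s |: U], which
    is free of x_s. *)
Lemma dbound_contr s (d : nat) (e : 'I_n) a : ((q ^ e).+1 <= d)%N ->
  dbound s d a -> dbound s d (contr (frob e) a).
Proof.
move=> ed ad U; rewrite contrE; apply: size_phi_sum => j jU.
rewrite -mulrA size_phi_signM phiM phi_frob.
have := ad (j |: U); rewrite !inE.
case: (eqVneq j s) => [js|js].
  subst j; rewrite (negPf jU) => /size1_polyC->.
  by rewrite mulrC mul_polyC (leq_trans (size_scale_leq _ _)) // size_polyXn.
by rewrite -polyC_exp mul_polyC; apply: leq_trans (size_scale_leq _ _).
Qed.

Lemma q_gt1 : (1 < q)%N.
Proof. exact: finNzRing_gt1. Qed.

Lemma dbound_ctr s (b : nat) (E : {set 'I_n}) a : E \subset below b ->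
  dbound s (q ^ b) a -> dbound s (q ^ b) (ctr frob E a).
Proof.
move=> EB; have {EB} : forall e, e \in enum E -> (e < b)%N.
  by move=> e; rewrite mem_enum => /(subsetP EB); rewrite inE.
rewrite /ctr; elim: (enum E) a => [a _ ad|e t IH a tb ad]; first exact: ad.
apply: (IH (contr (frob e) a)).
  by move=> i it; apply: tb; rewrite inE it orbT.
by apply: dbound_contr ad; rewrite ltn_exp2l ?q_gt1 // tb ?mem_head.
Qed.

Lemma dbound_ybas s (d : nat) W : (0 < d)%N -> dbound s d (ybas P W).
Proof.
move=> d0 U; rewrite ybasE; apply: (@leq_trans 1); last by case: ifP.
case: (U == W); first by rewrite mulr1n (rmorph1 (phi s)) size_poly1.
by rewrite mulr0n (rmorph0 (phi s)) size_poly0.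
Qed.

End Moore.

(** * Moore determinants as products of linear forms *)

Section MooreProduct.
Variables (F : finFieldType) (n : nat).
Local Notation P := {mpoly F[n]}.
Local Notation A := (extalg (mpoly n F) n).
Local Notation q := #|F|.
Local Notation frob := (@frob F n).
Local Notation below := (@below n).
Implicit Types (g : 'M[F]_n) (f : P) (a : A) (s j : 'I_n) (S U W : {set 'I_n}).

(** For b <= s, the Moore determinant of the first b variables together with x_s, with exponents 0,
    ..., b. *)
Definition moore (b : nat) s : P := ctr frob (below b.+1) (ybas P (s |: below b)) set0.

Lemma actP_moore g (b : nat) s :
  actP g (moore b s) = ctr frob (below b.+1) (actA g (ybas P (s |: below b))) set0.
Proof. by rewrite /moore -actA_coef0 actA_ctr. Qed.

(** The substitution sends y_s into the span of the y_c with c < b, hence the monomial on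
    [s |: below b] to 0. *)
Lemma moore_lform (b : nat) s (lam : {ffun {c : 'I_n | (c < b)%N} -> F}) : (b <= s)%N ->
  actP (colmx s (lvec lam)) (moore b s) = 0.
Proof.
move=> bs; rewrite actP_moore.
have sB : s \notin below b by rewrite inE -leqNgt.
suff -> : actA (colmx s (lvec lam)) (ybas P (s |: below b)) = 0 by rewrite linear0 ffunE.
rewrite ygenM_ybas_sign // (actA_scale _ _ (ygen P s * ybas P (below b))).
rewrite (actA_mul _ (ygen P s)) (actA_ygen _ s) (actA_colmx_ybas _ sB).
rewrite /lin_ygen /ylin mulr_suml big1 ?scaler0 // => i _; rewrite mxE eqxx -ext_scaleAl.
have [->|nz] := eqVneq (lvec lam i) 0; first by rewrite mpolyC0 scale0r.
by rewrite ybasM disjoints1 inE (lvec_ge nz) scaler0.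
Qed.

Lemma enum_below (b : nat) (bn : (b < n)%N) :
  enum (below b.+1) = rcons (enum (below b)) (Ordinal bn).
Proof.
apply: sorted_ltI_eq; first exact: sorted_enum.
  rewrite -cats1 (sorted_pairwise (@ltI_trans n)) pairwise_cat /= andbT.
  rewrite -(sorted_pairwise (@ltI_trans n)) sorted_enum andbT.
  by apply/allrelP => i j; rewrite mem_enum !inE => ib /eqP->.
by move=> j; rewrite mem_rcons inE !mem_enum !inE -val_eqE /= ltnS leq_eqVlt.
Qed.

Lemma size_Xn_sub_monic (p : {poly P}) (N : nat) : size p = N.+1 -> p \is monic ->
  (size ('X^N - p)%R <= N)%N.
Proof.
move=> sp /monicP; rewrite /lead_coef sp /= => pN; apply/leq_sizeP => i.
rewrite leq_eqVlt coefB coefXn eq_sym => /orP[/eqP->|Ni]; first by rewrite eqxx pN subrr.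
by rewrite gtn_eqF // nth_default ?sp // subrr.
Qed.

Lemma horner_phi_vprod (b : nat) s (lam : {ffun {c : 'I_n | (c < b)%N} -> F}) :
  (b <= s)%N -> (phi s (vprod F b s)).[lform lam] = 0.
Proof.
move=> bs; rewrite (phi_vprod _ bs) horner_prod; apply/eqP/prodf_eq0.
by exists (- lam) => //; rewrite hornerXsubC lformN opprK subrr.
Qed.

(* The difference has degree less than q^b in x_s and vanishes at the q^b values
   of x_s in the span of the first b variables. *)
Lemma moore_vprod (b : nat) s : (b <= s)%N ->
  exists k, moore b s = (-1) ^+ k * (topc frob (below b) * vprod F b s).
Proof.
move=> bs; have bn : (b < n)%N by apply: leq_ltn_trans bs (ltn_ord s).
have sB : s \notin below b by rewrite inE -leqNgt.
have [|k kE] := @contrs_ybasU P n (map frob (enum (below b))) (below b) [set s].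
  by rewrite disjoint_sym disjoints1.
exists k; set c := (-1) ^+ k * topc frob (below b).
have cE : ctr frob (below b) (ybas P (s |: below b)) [set s] = c.
  by rewrite setUC; apply: kE.
set beta := ctr frob (below b) (ybas P (s |: below b)) in cE.
have b_bound : dbound s (q ^ b) beta.
  apply: dbound_ctr => //; apply: dbound_ybas.
  by rewrite expn_gt0 (ltnW (q_gt1 F)).
(* The exponent b is contracted last; x_s^(q^b) occurs only in the term j = s, with coefficient
   [c]. *)
have ME : moore b s = frob (Ordinal bn) s * c +
    \sum_(j | j != s) frob (Ordinal bn) j * beta [set j].
  rewrite /moore {1}/ctr enum_below -cats1 map_cat contrs_cat /= -/(ctr frob (below b) _).
  rewrite -/beta contrE (bigD1 s) ?inE //= ext_inv0r expr0 mul1r setU0 cE; congr (_ + _).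
  by apply: eq_big => [j|j _]; rewrite ?inE // ext_inv0r expr0 mul1r setU0.
apply/eqP; rewrite mulrA -/c -subr_eq0; apply/eqP; set D := _ - _.
have phic : phi s c = c%:P.
  by rewrite /c phiM topc_const // rmorphXn rmorphN1 rmorphM rmorphXn rmorphN1.
have D0 lam : (phi s D).[@lform F n b lam] = 0.
  rewrite phiB hornerD hornerN phiM hornerM.
  have sub0 (u v w : P) : u = 0 -> w = 0 -> u - v * w = 0.
    by move=> -> ->; rewrite mulr0 subr0.
  have e1 := moore_lform lam bs; rewrite -horner_phi_lform in e1.
  exact: sub0 _ _ _ e1 (horner_phi_vprod lam bs).
have sD : (size (phi s D) <= q ^ b)%N.
  (* Both x_s^(q^b) and [vprod F b s] are monic of degree q^b in x_s, so their leading terms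
     cancel. *)
  have -> : D = (frob (Ordinal bn) s - vprod F b s) * c +
      \sum_(j | j != s) frob (Ordinal bn) j * beta [set j].
    by rewrite /D ME mulrBl addrAC [vprod _ _ _ * c]mulrC.
  rewrite phiD (leq_trans (size_polyD _ _)) // geq_max; apply/andP; split.
    rewrite phiM phic mulrC mul_polyC (leq_trans (size_scale_leq _ _)) //.
    rewrite phiB phi_frob eqxx; apply: size_Xn_sub_monic.
      exact: size_phi_vprod.
    by rewrite phi_vprod // monic_prod_XsubC.
  apply: size_phi_sum => j js; rewrite phiM phi_frob (negPf js) -polyC_exp mul_polyC.
  apply: leq_trans (size_scale_leq _ _) _.
  by have := b_bound [set j]; rewrite inE eq_sym (negPf js).
have [h Dh] := vprod_dvd D0.
(* With d = 0 the maximum is q^b, and the quotient is forced to have size 0. *)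
have := @size_phi_quot F n b s D h 0 bs Dh; rewrite (maxn_idPr _); last first.
  by rewrite expn_gt0 (ltnW (q_gt1 F)).
move=> /(_ sD); rewrite leqn0 size_poly_eq0 -(rmorph0 (phi s)) (inj_eq (@phi_inj F n s)).
by move=> /eqP h0; rewrite Dh h0 mulr0.
Qed.

Lemma topc_below_succ (b : nat) (bn : (b < n)%N) :
  topc frob (below b.+1) = moore b (Ordinal bn).
Proof.
rewrite /moore /topc; congr (ctr _ _ (ybas _ _) _).
by apply/setP => j; rewrite !inE -val_eqE /= ltnS leq_eqVlt.
Qed.

Lemma topc_below0 : topc frob (below 0) = 1.
Proof.
rewrite /topc; have -> : below 0 = set0 by apply/setP => j; rewrite !inE.
by rewrite /ctr enum_set0 /= ybasE eqxx.
Qed.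

Lemma topc_neq0 (b : nat) : (b <= n)%N -> topc frob (below b) != 0.
Proof.
elim: b => [|b IH] bn; first by rewrite topc_below0 oner_eq0.
rewrite (topc_below_succ bn); have [|k ->] := @moore_vprod b (Ordinal bn); first exact: leqnn.
by rewrite !mulf_neq0 ?signr_eq0 ?IH ?vprod_neq0 // ltnW.
Qed.

Lemma vprod_spec_neq0 (b : nat) s g : (forall i j, (j < b)%N -> g i j = 0) ->
  (forall i, g i s = (i == s)%:R) -> actP g (vprod F b s) != 0.
Proof.
move=> g0 gs; rewrite rmorph_prod /=; apply/prodf_neq0 => lam _.
rewrite rmorphD /= (_ : actP g (lform lam) = 0); last first.
  rewrite rmorph_sum big1 // => c _ /=; rewrite actPZ actP_X big1 ?scaler0 // => i _.
  by rewrite g0 ?scale0r // (valP c).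
rewrite add0r actP_X (bigD1 s) //= gs eqxx scale1r big1 ?addr0.
  apply/eqP => /(congr1 (fun f : P => f@_U_(s)%MM)).
  by rewrite mcoeffX eqxx mcoeff0; apply/eqP/oner_neq0.
by move=> i /negPf si; rewrite gs si scale0r.
Qed.

(* The substitution colmx c (lvec lam) is the reduction modulo x_c - lam.x. *)
Lemma topc_dvd (b : nat) f : (b <= n)%N ->
    (forall (c : 'I_n) (lam : {ffun {i : 'I_n | (i < c)%N} -> F}), (c < b)%N ->
       actP (colmx c (lvec lam)) f = 0) ->
  exists h, f = topc frob (below b) * h.
Proof.
elim: b f => [|b IH] f bn f0; first by exists f; rewrite topc_below0 mul1r.
pose s := Ordinal bn.
have [lam|h fh] := @vprod_dvd F n b s f.
  by rewrite horner_phi_lform; apply: (f0 s lam); apply: ltnSn.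
have [|c lam cb|h' hh'] := IH h; first exact: ltnW.
  have := f0 c lam (ltnW cb); rewrite fh rmorphM /= => /eqP; rewrite mulf_eq0.
  case/orP=> /eqP // v0.
  (* [G] kills all variables but x_s. It keeps the reduction of [vprod F b s] modulo x_c - lam.x
     nonzero, so that the vanishing of f passes to h. *)
  pose G : 'M[F]_n := \matrix_(i, j) ((i == s) && (j == s))%:R.
  have : actP (G *m colmx c (lvec lam)) (vprod F b s) != 0.
    have cs : s != c by rewrite -val_eqE /= gtn_eqF.
    apply: vprod_spec_neq0 => [i j jb|i].
      rewrite mxE big1 // => k _; rewrite !mxE.
      case: (k =P s) => [->|_]; last by rewrite andbF mul0r.
      have [_|_] := eqVneq j c.
        have [->|nz] := eqVneq (lvec lam s) 0; first by rewrite mulr0.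
        by have := lvec_ge nz; rewrite /= ltnNge (ltnW cb).
      rewrite (_ : (s == j) = false) ?mulr0 //.
      by rewrite -val_eqE /= gtn_eqF.
    rewrite mxE (bigD1 s) //= !mxE (negPf cs) eqxx mulr1 andbT big1 ?addr0 // => k ks.
    by rewrite !mxE (negPf ks) andbF mul0r.
  by rewrite -actP_comp v0 rmorph0 eqxx.
have [|k kE] := @moore_vprod b s; first exact: leqnn.
exists ((-1) ^+ k * h'); rewrite (topc_below_succ bn) kE fh hh'.
have : (-1) ^+ k * (-1) ^+ k = 1 :> P by rewrite -expr2 sqrr_sign.
move: ((-1) ^+ k) (vprod F b s) (topc _ _) => e v t ee.
by rewrite mulrACA mulrA ee mul1r; ring.
Qed.

End MooreProduct.

(** * Polynomial invariants *)

Section Composition.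
Variables (F : finFieldType) (n : nat) (I : seq nat) (sumI : sumn I = n).
Local Notation P := {mpoly F[n]}.
Local Notation A := (extalg (mpoly n F) n).
Local Notation frob := (@frob F n).
Local Notation below := (@below n).
Local Notation t := (tau I).
Implicit Types (g : 'M[F]_n) (f : P) (a : A) (s j : 'I_n) (S U W : {set 'I_n}).

Lemma sumn_take_mono (k l : nat) : (k <= l)%N -> (sumn (take k I) <= sumn (take l I))%N.
Proof.
by move=> kl; rewrite -(take_takel I kl) -{2}(cat_take_drop k (take l I)) sumn_cat leq_addr.
Qed.

Lemma tau_le (i : nat) : (t i <= i)%N.
Proof. by rewrite -{2}(reshape_indexK I i) leq_addr. Qed.

Lemma tau_mono (i j : nat) : (i <= j)%N -> (t i <= t j)%N.
Proof.
rewrite (reshape_leq I) => ij; apply: sumn_take_mono.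
by case/orP: ij => [/ltnW//|/andP[/eqP-> _]].
Qed.

(** [tau I j] is the first index of the block of j, so membership in U_I can be expressed by tau
    alone. *)
Lemma ltn_tau (i : 'I_n) (j : nat) : (i < t j)%N = (reshape_index I i < reshape_index I j)%N.
Proof.
have iI : (i < sumn I)%N by rewrite sumI.
apply/idP/idP => [|ij].
  rewrite !ltnNge; apply: contra => /sumn_take_mono ji.
  exact: leq_trans ji (tau_le i).
apply: leq_trans (sumn_take_mono ij); rewrite (take_nth 0%N) ?reshape_indexP //.
by rewrite sumn_rcons -{1}(reshape_indexK I i) ltn_add2l reshape_offsetP.
Qed.

Lemma UIP g : reflect (forall i j : 'I_n, ~~ (i < t j)%N -> g i j = (i == j)%:R) (g \in UI F n I).
Proof.
rewrite inE; apply: (iffP forallP) => [gU i j|gU i].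
  rewrite ltn_tau -leqNgt leq_eqVlt.
  have /forallP/(_ j)/andP[/implyP g1 /implyP g2] := gU i.
  case: eqP => [e _|_ /= lt_ji]; first by apply/eqP/g1; rewrite e.
  rewrite (eqP (g2 lt_ji)); case: (i =P j) => // ij.
  by rewrite ij ltnn in lt_ji.
apply/forallP => j; apply/andP; split; apply/implyP.
  by move=> /eqP e; apply/eqP/gU; rewrite ltn_tau e ltnn.
move=> lt_ji; rewrite gU; last by rewrite ltn_tau -leqNgt ltnW.
by case: (i =P j) lt_ji => [->|]; rewrite ?ltnn.
Qed.

(** The terms that g adds to y_j have indices i < tau(j); for j in S these are below b, and for j <
    b they are below j. *)
Lemma UI_ybas g (b : nat) S : g \in UI F n I -> (forall j, j \in S -> (t j <= b)%N) ->
  actA g (ybas P (below b :|: S)) = ybas P (below b :|: S).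
Proof.
move=> /UIP gU Sb; apply: actA_ybas_fix => [j _|i j jW ij gij].
  by rewrite gU ?eqxx // -leqNgt tau_le.
have itj : (i < t j)%N.
  by apply: contraNT gij => itj; rewrite gU // (negPf ij).
have lt_ij := leq_trans itj (tau_le j); rewrite lt_ij andbT !inE.
move: jW; rewrite !inE => /orP[jb|/Sb tb]; first by rewrite (ltn_trans lt_ij jb).
by rewrite (leq_trans itj tb).
Qed.

Lemma UI_kform g (b : nat) S : g \in UI F n I -> (forall j, j \in S -> (t j <= b)%N) ->
  actA g (kform frob (below b) S) = kform frob (below b) S.
Proof. by move=> gU Sb; rewrite /kform actA_ctr UI_ybas. Qed.

Lemma UI_topc g (b : nat) : g \in UI F n I ->
  actP g (topc frob (below b)) = topc frob (below b).
Proof.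
move=> gU; rewrite /topc -actA_coef0 actA_ctr -[below b]setU0 UI_ybas // => j.
by rewrite inE.
Qed.

(** v_s is, up to sign, the quotient of two Moore determinants, both of them contractions of
    invariant monomials; no permutation of its factors is followed. *)
Lemma UI_vprod g s : g \in UI F n I -> actP g (vprod F (t s) s) = vprod F (t s) s.
Proof.
move=> gU; have [|k kE] := @moore_vprod F n (t s) s; first exact: tau_le.
have gm : actP g (moore F (t s) s) = moore F (t s) s.
  rewrite actP_moore setUC UI_ybas //; first by rewrite setUC.
  by move=> j; rewrite inE => /eqP->.
have nz : (-1) ^+ k * topc frob (below (t s)) != 0.
  rewrite mulf_neq0 ?signr_eq0 ?topc_neq0 //.
  by rewrite (leq_trans (tau_le s)) // ltnW.
apply: (mulfI nz); rewrite -!mulrA -kE -[RHS]gm kE.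
by rewrite !rmorphM /= rmorph_sign UI_topc.
Qed.

(** Kills x_j and y_j for j >= m. Being fixed by it means involving the first m variables only, the
    level on which the inductions run. *)
Definition pidm (m : nat) : 'M[F]_n := \matrix_(i, j) ((i == j) && (j < m)%N)%:R.

Lemma mul_pidmE m g i j : (g *m pidm m) i j = g i j * (j < m)%:R.
Proof.
rewrite mxE (bigD1 j) //= mxE eqxx /= big1 ?addr0 // => k kj.
by rewrite mxE (negPf kj) mulr0.
Qed.

Lemma pidm_mulE m g i j : (pidm m *m g) i j = (i < m)%:R * g i j.
Proof.
rewrite mxE (bigD1 i) //= mxE eqxx /= big1 ?addr0 // => k ki.
by rewrite mxE eq_sym (negPf ki) mul0r.
Qed.

Lemma pidm_pidm m m' : (m <= m')%N -> pidm m' *m pidm m = pidm m.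
Proof.
move=> mm'; apply/matrixP => i j; rewrite mul_pidmE !mxE.
case: (i =P j) => [_|_]; last by rewrite mul0r.
by case: (ltnP j m) => jm; rewrite ?mulr0 //= (leq_trans jm mm') mulr1.
Qed.

(** Built so that [g *m pidm m] equals [pidm m *m colmod g m] with the second factor again in U_I;
    hence [pidm m] preserves invariants. *)
Definition colmod g (m : nat) : 'M[F]_n :=
  \matrix_(i, j) if (j < m)%N then g i j else (i == j)%:R.

Lemma colmod_UI g m : g \in UI F n I -> colmod g m \in UI F n I.
Proof.
by move=> /UIP gU; apply/UIP => i j ij; rewrite mxE; case: ifP => // _; apply: gU.
Qed.

Lemma pidm_colmod g m : g \in UI F n I -> pidm m *m colmod g m = g *m pidm m.
Proof.
move=> /UIP gU; apply/matrixP => i j; rewrite mul_pidmE pidm_mulE mxE.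
case: (ltnP j m) => jm.
  rewrite mulr1; case: (ltnP i m) => im; first by rewrite mul1r.
  have ji : (j < i)%N by apply: leq_trans jm im.
  rewrite mul0r gU; last by rewrite -leqNgt (leq_trans (tau_le j)) // ltnW.
  by case: (i =P j) ji => [->|]; rewrite ?ltnn.
rewrite mulr0; case: (i =P j) => [->|_]; last by rewrite mulr0.
by rewrite ltnNge jm mul0r.
Qed.

Lemma invPP f : reflect (forall g, g \in UI F n I -> actP g f = f) (f \in @invP F n I).
Proof.
by apply: (iffP forall_inP) => h g gU; apply/eqP; [apply: h|rewrite h].
Qed.

Lemma invAP a : reflect (forall g, g \in UI F n I -> actA g a = a) (a \in @invA F n I).
Proof. by apply: (iffP forall_inP) => h g gU; apply/eqP/h. Qed.

Lemma invP_pidm m f : f \in invP I -> actP (pidm m) f \in invP I.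
Proof.
move=> /invPP fU; apply/invPP => g gU.
rewrite (actP_comp g (pidm m) f) -(pidm_colmod m gU) -(actP_comp (pidm m)).
by rewrite (fU _ (colmod_UI m gU)).
Qed.

Lemma invA_pidm m a : a \in invA I -> actA (pidm m) a \in invA I.
Proof.
move=> /invAP aU; apply/invAP => g gU.
rewrite (actA_comp g (pidm m) a) -(pidm_colmod m gU) -(actA_comp (pidm m)).
by rewrite (aU _ (colmod_UI m gU)).
Qed.

Definition tmat s (v : 'I_n -> F) : 'M[F]_n :=
  \matrix_(i, j) if (j == s) && (i != s) then v i else (i == j)%:R.

Lemma tmat_UI s (lam : {ffun {c : 'I_n | (c < t s)%N} -> F}) :
  tmat s (lvec lam) \in UI F n I.
Proof.
apply/UIP => i j; rewrite mxE; case: (j =P s) => [->|//]; case: (i =P s) => [->|/eqP si] //= its.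
by have [->|/lvec_ge] := eqVneq (lvec lam i) 0; last by rewrite (negPf its).
Qed.

(** Products act from the right factor on: translating x_s by lam.x and then killing x_s amounts, at
    level s+1, to x_s := lam.x. As [tmat] lies in U_I, an invariant of that level has the same value
    at lam.x as at 0. *)
Lemma pidm_tmat s (lam : {ffun {c : 'I_n | (c < t s)%N} -> F}) :
  pidm s *m tmat s (lvec lam) = colmx s (lvec lam) *m pidm s.+1.
Proof.
apply/matrixP => i j; rewrite mul_pidmE pidm_mulE !mxE.
case: (j =P s) => [->|/eqP js] /=.
  rewrite ltnSn mulr1; have [->|/lvec_ge its] := eqVneq (lvec lam i) 0.
    by case: (i =P s) => [->|]; rewrite /= ?ltnn ?mul0r ?mulr0.
  have lt_is := leq_trans its (tau_le s).
  by rewrite lt_is mul1r ifT // -val_eqE /= ltn_eqF.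
rewrite mulrC; case: (i =P j) => [->|_]; last by rewrite !mul0r.
by rewrite ltnS [in RHS]leq_eqVlt val_eqE (negPf js).
Qed.

Lemma actP_colmx s (lam : {ffun {c : 'I_n | (c < t s)%N} -> F}) f :
  f \in invP I -> actP (pidm s.+1) f = f ->
  actP (colmx s (lvec lam)) f = actP (pidm s) f.
Proof.
move=> /invPP fU fs; rewrite -{1}fs actP_comp -pidm_tmat -actP_comp.
by rewrite fU ?tmat_UI.
Qed.

Lemma phi_pidm s f : actP (pidm s) f = f -> phi s f = f%:P.
Proof.
move=> fs; rewrite -fs phi_const // => j; rewrite mxE; case: (s =P j) => [<-|//].
by rewrite ltnn.
Qed.

Lemma actP_pidm0 f : exists c, actP (pidm 0) f = c%:MP.
Proof.
exists (meval (fun _ => 0) f).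
apply: (@mpoly_rmorph_eq F n _ (actP (pidm 0))
  (mpolyC n (R := F) \o meval (fun _ => 0))) => [c|j] /=.
  by rewrite actP_C mevalC.
rewrite actP_X mevalXU mpolyC0 big1 // => i _.
by rewrite mxE ltn0 andbF scale0r.
Qed.

Section PolynomialInvariants.
Variable gens : n.-tuple P.
Hypothesis gensE : forall s, tnth gens s = vprod F (t s) s.

Lemma comp_gens_X s : 'X_s \mPo gens = vprod F (t s) s.
Proof. by rewrite comp_mpolyXU -tnth_nth gensE. Qed.

Lemma comp_gens_inv h : h \mPo gens \in invP I.
Proof.
apply/invPP => g gU.
apply: (@mpoly_rmorph_eq F n _ (actP g \o comp_mpoly gens) (comp_mpoly gens)) => [c|s] /=.
  by rewrite comp_mpolyC actP_C.
by rewrite comp_gens_X UI_vprod.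
Qed.

Lemma vprod_quot s f h : f = vprod F (t s) s * h -> f \in invP I ->
  actP (pidm s.+1) f = f -> h \in invP I /\ actP (pidm s.+1) h = h.
Proof.
move=> fh /invPP fU fs; have v0 : vprod F (t s) s != 0 by apply/vprod_neq0/tau_le.
split.
  apply/invPP => g gU; apply: (mulfI v0); rewrite -fh -[RHS](fU g gU) fh.
  by rewrite rmorphM /= UI_vprod.
apply: (mulfI v0); rewrite -fh -[RHS]fs fh rmorphM /= actP_vprod // => i j js.
rewrite mxE; case: (i =P j) => //= _; rewrite ltnS.
case/orP: js => [jt|/eqP->]; last by rewrite leqnn.
by rewrite (leq_trans (ltnW jt) (tau_le s)).
Qed.

Lemma invP_gens_level m f : (m <= n)%N -> f \in invP I -> actP (pidm m) f = f ->
  exists h, f = h \mPo gens.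
Proof.
elim: m f => [|m IHm] f mn fU fm.
  by have [c cE] := actP_pidm0 f; exists c%:MP; rewrite comp_mpolyC -cE fm.
pose s := Ordinal mn.
have [d] : exists d, (size (phi s f) <= d)%N by exists (size (phi s f)).
elim: d f fU fm => [|d IHd] f fU fm fd.
  exists 0; rewrite (rmorph0 (comp_mpoly gens)); apply: (@phi_inj F n s).
  by rewrite (rmorph0 (phi s)); apply/eqP; rewrite -size_poly_eq0 -leqn0.
(* [f0] is f at x_s = 0 and falls under the outer induction; [f - f0] is v_s times an invariant of
   smaller degree in x_s. *)
pose f0 := actP (pidm m) f.
have f0U : f0 \in invP I by apply: invP_pidm.
have f0m : actP (pidm m) f0 = f0 by rewrite /f0 actP_comp pidm_pidm.
have f0m1 : actP (pidm m.+1) f0 = f0 by rewrite /f0 actP_comp pidm_pidm.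
have [h0 h0E] := IHm f0 (ltnW mn) f0U f0m.
have dU : f - f0 \in invP I.
  apply/invPP => g gU; rewrite actPB.
  exact: (f_equal2 (fun x y : P => x - y) (invPP _ fU _ gU) (invPP _ f0U _ gU)).
have dm : actP (pidm s.+1) (f - f0) = f - f0.
  by rewrite actPB; exact: (f_equal2 (fun x y : P => x - y) fm f0m1).
have [|h hE] := @vprod_dvd F n (t s) s (f - f0).
  move=> lam; rewrite horner_phi_lform (actP_colmx _ dU dm) actPB.
  by rewrite -[X in X - _]/f0 f0m subrr.
have [hU hm] := vprod_quot hE dU dm.
have [|h1 h1E] := IHd h hU hm.
  apply: (@size_phi_quot F n (t s) s (f - f0) h d (tau_le s) hE).
  rewrite leq_max; apply/orP; left.
  have f0d : (size (phi s f0) <= d.+1)%N.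
    by rewrite (@phi_pidm s f0 f0m); apply: leq_trans (size_polyC_leq1 _) _.
  rewrite phiB; apply: leq_trans (size_polyD _ _) _.
  by rewrite geq_max size_polyN; apply/andP; split; [exact: fd | exact: f0d].
exists (h0 + 'X_s * h1).
rewrite (rmorphD (comp_mpoly gens)) (rmorphM (comp_mpoly gens)) /= comp_gens_X.
by rewrite -h1E -hE -h0E addrC subrK.
Qed.

End PolynomialInvariants.
End Composition.

(** * Algebraic independence of the generators *)

Section AlgebraicIndependence.
Variables (F : finFieldType) (n : nat) (I : seq nat).
Local Notation P := {mpoly F[n]}.
Local Notation t := (tau I).
Local Notation pidm := (pidm F n).
Implicit Types (f h : P) (s j : 'I_n).

Lemma vprod0 s : vprod F 0 s = 'X_s.
Proof.
rewrite /vprod (eq_bigr (fun _ => 'X_s)) => [|lam _].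
  by rewrite prodr_const card_ffun (@card_ltn_sig n 0) // expn0 expr1.
by rewrite /lform big1 ?add0r // => -[c c0].
Qed.

Lemma actP_pidm_X m j : actP (pidm m) 'X_j = if (j < m)%N then 'X_j else 0.
Proof.
rewrite actP_X (bigD1 j) //= mxE eqxx big1 ?addr0 => [|i ij].
  by case: ifP => _; rewrite ?scale1r ?scale0r.
by rewrite mxE (negPf ij) scale0r.
Qed.

Lemma actP_pidm_full f : actP (pidm n) f = f.
Proof.
apply: (@mpoly_rmorph_eq F n _ (actP (pidm n)) idfun) => [c|j] /=; first exact: actP_C.
by rewrite actP_pidm_X ltn_ord.
Qed.

Lemma pidm_id m i j : (j < m)%N -> pidm m i j = (i == j)%:R.
Proof. by move=> jm; rewrite mxE jm andbT. Qed.

Lemma actP_pidm_vprod (b m : nat) j : (b <= j)%N ->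
  actP (pidm m) (vprod F b j) = if (j < m)%N then vprod F b j else 0.
Proof.
move=> bj; case: ifPn => jm.
  apply: actP_vprod => i k kj; apply: pidm_id.
  by case/orP: kj => [kb|/eqP->//]; apply: leq_trans kb (leq_trans bj (ltnW jm)).
rewrite rmorph_prod /=; apply/eqP/prodf_eq0; exists 0 => //.
rewrite rmorphD /= actP_pidm_X (negPf jm) addr0 /lform big1 ?rmorph0 // => c _.
by rewrite ffunE scale0r.
Qed.

(** Killing the last variables kills the corresponding v_s and fixes the others, so it commutes with
    substitution of the generators. A relation at x_s = 0 is thus a relation of lower level, hence
    trivial; so x_s divides h, and v_s can be cancelled. *)
Lemma comp_gens_eq0 (gens : n.-tuple P) h :
  (forall s, tnth gens s = vprod F (t s) s) -> h \mPo gens = 0 -> h = 0.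
Proof.
move=> gensE; suff level m : (m <= n)%N -> forall h, actP (pidm m) h = h ->
    h \mPo gens = 0 -> h = 0.
  exact: (level n (leqnn n) h (actP_pidm_full h)).
elim: m => [|m IHm] mn {}h hm h0.
  have [c cE] := actP_pidm0 h; move: h0.
  by rewrite -hm cE comp_mpolyC.
pose s := Ordinal mn.
have [d] : exists d, (size (phi s h) <= d)%N by exists (size (phi s h)).
elim: d h hm h0 => [|d IHd] h hm h0 hd.
  apply: (@phi_inj F n s); rewrite (rmorph0 (phi s)); apply/eqP.
  by rewrite -size_poly_eq0 -leqn0.
have pidm_comp f : actP (pidm m) f \mPo gens = actP (pidm m) (f \mPo gens).
  apply: (@mpoly_rmorph_eq F n _ (comp_mpoly gens \o actP (pidm m))
    (actP (pidm m) \o comp_mpoly gens)) => [c|j] /=.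
    by rewrite actP_C comp_mpolyC actP_C.
  rewrite (comp_gens_X gensE) actP_pidm_vprod ?tau_le // actP_pidm_X.
  by case: ifP => _; rewrite ?(comp_gens_X gensE) ?(rmorph0 (comp_mpoly gens)).
have hm0 : actP (pidm m) h = 0.
  apply: (IHm (ltnW mn)); first by rewrite (actP_comp (pidm m) (pidm m)) pidm_pidm.
  by rewrite pidm_comp h0 (rmorph0 (actP (pidm m))).
(* For b = 0 the product is the variable itself and the empty lam gives the root 0. *)
have [lam|h' hh'] := @vprod_dvd F n 0 s h.
  rewrite horner_phi_lform -[in LHS]hm actP_comp -[RHS]hm0; congr (actP _ h).
  apply/matrixP => i j; rewrite mul_pidmE !mxE.
  have -> : lvec lam i = 0 by apply/eqP/negPn/negP => /lvec_ge.
  rewrite -[(j < m)%N]andTb ltnS leq_eqVlt -[(j : nat) == m]/(j == s :> nat) val_eqE.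
  case: (j =P s) => [->|_] /=; first by rewrite mul0r ltnn andbF.
  by case: (i == j); rewrite ?mul0r // mul1r.
have X0 : vprod F 0 s != 0 by apply: vprod_neq0.
have h'm : actP (pidm m.+1) h' = h'.
  apply: (mulfI X0); rewrite -[RHS]hh' -[RHS]hm [in RHS]hh' rmorphM /=.
  by rewrite actP_pidm_vprod // ltnSn.
have h'0 : h' \mPo gens = 0.
  have v0 : vprod F (t s) s != 0 by apply/vprod_neq0/tau_le.
  apply: (mulfI v0); rewrite mulr0 -[RHS]h0 hh' vprod0.
  by rewrite (rmorphM (comp_mpoly gens)) /= (comp_gens_X gensE).
rewrite hh' (IHd h' h'm h'0) ?mulr0 //.
apply: (@size_phi_quot F n 0 s h h' d (leq0n s) hh').
by rewrite leq_max hd.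
Qed.

End AlgebraicIndependence.

(** * Exterior invariants: freeness *)

Section ExteriorInvariants.
Variables (F : finFieldType) (n : nat) (I : seq nat) (sumI : sumn I = n).
Local Notation P := {mpoly F[n]}.
Local Notation A := (extalg (mpoly n F) n).
Local Notation q := #|F|.
Local Notation frob := (@frob F n).
Local Notation below := (@below n).
Local Notation t := (tau I).
Local Notation Nf S := (Nform F q (tau_set I S) S).
Local Notation K b S := (kform frob (below b) S).
Implicit Types (g : 'M[F]_n) (f : P) (a : A) (s j : 'I_n) (S U W : {set 'I_n}).

Lemma tau_set_max s S : s \in S -> (forall j, j \in S -> (j <= s)%N) -> tau_set I S = t s.
Proof.
move=> sS smax; rewrite /tau_set (enum_set_split S s) sS.
rewrite [X in _ ++ _ ++ X](_ : _ = [::]); last first.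
  apply/eqP; rewrite -size_eq0 size_filter -leqn0 leqNgt -has_count.
  by apply/hasPn => j; rewrite mem_enum => /smax; rewrite leqNgt.
by rewrite map_cat last_cat /=.
Qed.

Lemma set_max S : S != set0 -> exists2 s, s \in S & forall j, j \in S -> (j <= s)%N.
Proof.
case/set0Pn=> s0 s0S; case: (@arg_maxnP _ s0 (mem S) (fun s => s : nat) s0S) => s sS smax.
by exists s.
Qed.

Lemma Nform_max s S : s \in S -> (forall j, j \in S -> (j <= s)%N) ->
  exists k, Nf S = (-1) ^+ k *: K (t s) S.
Proof.
move=> sS smax; rewrite (tau_set_max sS smax); apply: Nform_kform.
  by rewrite (leq_trans (tau_le I s)) // ltnW.
by apply/set0Pn; exists s.
Qed.

Lemma Nform0 : Nf (set0 : {set 'I_n}) = 1 :> A.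
Proof. by rewrite /Nform eqxx. Qed.

Lemma invP_N1X k : (-1) ^+ k \in @invP F n I.
Proof. by apply/invPP => g _; rewrite (rmorphXn (actP g)) (rmorphN1 (actP g)). Qed.

Lemma invAZ c a : c \in invP I -> a \in @invA F n I -> c *: a \in invA I.
Proof.
move=> /invPP cU /invAP aU; apply/invAP => g gU.
by rewrite (actA_scale g c a) (cU g gU) (aU g gU).
Qed.

Lemma invAD a (b : A) : a \in @invA F n I -> b \in invA I -> a + b \in invA I.
Proof.
move=> /invAP aU /invAP bU; apply/invAP => g gU.
by rewrite (actA_additive g a b) (aU g gU) (bU g gU).
Qed.

Lemma invAB a (b : A) : a \in @invA F n I -> b \in invA I -> a - b \in invA I.
Proof.
move=> /invAP aU /invAP bU; apply/invAP => g gU; rewrite (raddfB (actA g)).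
exact: (f_equal2 (fun x y : A => x - y) (aU g gU) (bU g gU)).
Qed.

Lemma kform_inv s S : (forall j, j \in S -> (j <= s)%N) -> K (t s) S \in invA I.
Proof.
by move=> smax; apply/invAP => g gU; apply: (UI_kform sumI gU) => j /smax; apply: tau_mono.
Qed.

Lemma Nform_inv S : Nf S \in invA I.
Proof.
have [->|S0] := eqVneq S set0.
  by rewrite Nform0; apply/invAP => g _; apply: actA_1.
have [s sS smax] := set_max S0; have [k ->] := Nform_max sS smax.
by apply: invAZ; [apply: invP_N1X | apply: kform_inv].
Qed.

Definition Nspan a : Prop :=
  exists2 c : {set 'I_n} -> P, (forall S, c S \in invP I) & a = \sum_S c S *: Nf S.

Lemma invP0 : 0 \in @invP F n I.
Proof. by apply/invPP => g _; rewrite rmorph0. Qed.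

Lemma invP1 : 1 \in @invP F n I.
Proof. by apply/invPP => g _; rewrite rmorph1. Qed.

Lemma invPM (f h : P) : f \in invP I -> h \in @invP F n I -> f * h \in invP I.
Proof.
move=> /invPP fU /invPP hU; apply/invPP => g gU.
by rewrite rmorphM /= (fU g gU) (hU g gU).
Qed.

Lemma invPD (f h : P) : f \in invP I -> h \in @invP F n I -> f + h \in invP I.
Proof.
move=> /invPP fU /invPP hU; apply/invPP => g gU.
by rewrite rmorphD /= (fU g gU) (hU g gU).
Qed.

Lemma NspanD a (b : A) : Nspan a -> Nspan b -> Nspan (a + b).
Proof.
move=> [c cU ->] [d dU ->]; exists (fun S => c S + d S) => [S|]; first exact: invPD.
by rewrite -big_split; apply: eq_bigr => S _; rewrite scalerDl.
Qed.

Lemma NspanZ c a : c \in invP I -> Nspan a -> Nspan (c *: a).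
Proof.
move=> cU [d dU ->]; exists (fun S => c * d S) => [S|]; first exact: invPM.
by rewrite scaler_sumr; apply: eq_bigr => S _; rewrite scalerA.
Qed.

Lemma Nspan0 : Nspan 0.
Proof.
exists (fun _ => 0) => [S|]; first exact: invP0.
by rewrite big1 // => S _; rewrite scale0r.
Qed.

Lemma Nspan_N S : Nspan (Nf S).
Proof.
exists (fun T => (T == S)%:R) => [T|].
  by case: (T == S); [apply: invP1 | apply: invP0].
rewrite (bigD1 S) //= eqxx scale1r big1 ?addr0 // => T /negPf->.
by rewrite scale0r.
Qed.

Lemma Nspan_sum (J : finType) (a : J -> A) : (forall u, Nspan (a u)) -> Nspan (\sum_u a u).
Proof.
by move=> aN; elim/big_ind: _ => //; [apply: Nspan0 | apply: NspanD].
Qed.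

Lemma Nspan_inv a : Nspan a -> a \in invA I.
Proof.
move=> [c cU ->]; elim/big_rec: _ => [|S b _ bU].
  by apply/invAP => g _; apply: (raddf0 (actA g)).
by apply: invAD bU; apply: invAZ; [apply: cU | apply: Nform_inv].
Qed.

End ExteriorInvariants.

Section ExteriorBasis.
Variables (F : finFieldType) (n : nat) (I : seq nat).
Local Notation P := {mpoly F[n]}.
Local Notation A := (extalg (mpoly n F) n).
Local Notation q := #|F|.
Local Notation frob := (@frob F n).
Local Notation below := (@below n).
Local Notation t := (tau I).
Local Notation Nf S := (Nform F q (tau_set I S) S).
Local Notation K b S := (kform frob (below b) S).
Implicit Types (g : 'M[F]_n) (f : P) (a : A) (s j : 'I_n) (S T U W : {set 'I_n}).

(** As s is not below b, removing it from S leaves the set of exponents unchanged. *)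
Lemma contr_delta_kform_in (b : nat) s S : (b <= s)%N -> s \in S ->
  exists k, contr (delta s) (K b S) = (-1) ^+ k *: K b (S :\ s).
Proof.
move=> bs sS; have sB : s \notin below b by rewrite inE -leqNgt.
rewrite /kform; have -> : below b :\: S = below b :\: (S :\ s).
  by apply/setP => j; rewrite !inE; case: (j =P s) => // ->; rewrite ltnNge bs !andbF.
have -> : below b :|: S = s |: (below b :|: (S :\ s)) by rewrite setUCA setD1K.
have sW : s \notin below b :|: (S :\ s) by rewrite !inE eqxx orbF -leqNgt.
have [k kE] := contr_delta_ybas P sW.
have := contrs_contr (map frob (enum (below b :\: (S :\ s)))) (delta s)
  (ybas P (s |: (below b :|: S :\ s))).
rewrite kE contrsZ => e.
set m := size _ in e; exists (m + k)%N.
rewrite exprD -scalerA -/(ctr frob _ _) [X in _ = _ *: X]e scalerA -expr2 sqrr_sign.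
by rewrite scale1r.
Qed.

Lemma contr_delta_kform_notin (b : nat) s S : s \notin below b :|: S ->
  contr (delta s) (K b S) = 0.
Proof.
move=> sW; apply/contrs_mem0/ffunP => U; rewrite contr_delta [RHS]ffunE; case: ifP => // _.
by rewrite ybasE; case: (_ =P _) sW => [<-|_ _]; rewrite ?setU11 // mulr0.
Qed.

(** The forms N_{tau(S),S} belong to different values of b. For the largest index s still present,
    contraction along y_s kills those with s not in S and turns the others into the forms of S minus
    s for the single value b = tau(s), which are independent. *)
Lemma Nform_free (c : {set 'I_n} -> P) : \sum_S c S *: Nf S = 0 -> forall S, c S = 0.
Proof.
suff level m : (m <= n)%N -> (forall S, ~~ (S \subset below m) -> c S = 0) ->
    \sum_S c S *: Nf S = 0 -> forall S, c S = 0.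
  apply: (level n (leqnn n)) => S /subsetPn[j _].
  by rewrite inE ltn_ord.
elim: m => [|m IHm] mn c0 e.
  have b0 : below 0 = set0 by apply/setP => j; rewrite !inE.
  rewrite b0 in c0; move: e; rewrite (bigD1 set0) //= Nform0 big1 ?addr0 => [e S|S S0].
    have [->|S0] := eqVneq S set0; last by apply: c0; rewrite subset0.
    by apply: (@ext_scalar_inj P n); rewrite e scale0r.
  by rewrite c0 ?scale0r // subset0.
apply: (IHm (ltnW mn)) => // S Sm.
pose s := Ordinal mn.
case: (boolP (S \subset below m.+1)) => Sm1; last exact: c0.
have max_s T : T \subset below m.+1 -> forall j, j \in T -> (j <= s)%N.
  by move=> /subsetP Tm j /Tm; rewrite inE.
have sS : s \in S.
  case/subsetPn: Sm => j jS; rewrite inE -leqNgt => mj.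
  suff <- : j = s by [].
  by apply/val_inj/eqP; rewrite eqn_leq mj (max_s S).
have /fin_all_exists[d dE] : forall T : {set 'I_n}, exists d : P,
    contr (delta s) (c T *: Nf T) = (if s \in T then d *: K (t s) (T :\ s) else 0)
    /\ (s \in T -> d = 0 -> c T = 0).
  move=> T; case: (boolP (T \subset below m.+1)) => Tm; last first.
    exists 0; rewrite c0 // !scale0r linear0; split=> //.
    by case: ifP.
  case: (boolP (s \in T)) => sT.
    have [k kE] := Nform_max F I sT (max_s T Tm).
    have [k' k'E] := contr_delta_kform_in (tau_le I s) sT.
    exists (c T * ((-1) ^+ k * (-1) ^+ k')); split.
      exact: (contr_scale (c T) kE k'E).
    by move=> _ /eqP; rewrite !mulf_eq0 !signr_eq0 !orbF => /eqP.
  exists 0; split=> //; rewrite contrZ; have [->|T0] := eqVneq T set0.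
    by rewrite Nform0 contr1 scaler0.
  have [u uT umax] := set_max T0; have [k ->] := Nform_max F I uT umax.
  rewrite contrZ contr_delta_kform_notin ?scaler0 // !inE (negPf sT) orbF -leqNgt.
  exact: leq_trans (tau_le I u) (max_s T Tm u uT).
have : \sum_(T : {set 'I_n} | s \in T) d T *: K (t s) (T :\ s) = 0.
  have e' : \sum_T contr (delta s) (c T *: Nf T) = 0.
    by have := congr1 (contr (delta s)) e; rewrite linear0 linear_sum.
  rewrite -[RHS]e' big_mkcond; apply: eq_bigr => T _.
  exact: esym (dE T).1.
rewrite (reindex_onto (fun T => s |: T) (fun T => T :\ s)); last first.
  by move=> T /setD1K.
rewrite (eq_bigl (fun T => s \notin T)) => [|T]; last first.
  rewrite setU11 /=; apply/eqP/idP => [<-|sT]; first by rewrite !inE eqxx.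
  by rewrite setU1K.
rewrite big_mkcond /= => e2.
have [_ dc] := dE S; apply: dc => //.
have tn : (t s <= n)%N := leq_trans (tau_le I s) (ltnW (ltn_ord s)).
have free := @kform_free P n frob (below (t s)) (fun T => if s \notin T then d (s |: T) else 0)
  (topc_neq0 F tn).
have := free _ (S :\ s); rewrite !inE eqxx /= setD1K //; apply.
rewrite -[RHS]e2; apply: eq_bigr => T _; case: ifP => sT; last by rewrite scale0r.
by rewrite setU1K.
Qed.

Lemma Nform_inj : injective (fun S => Nf S).
Proof.
move=> S T NST; apply/eqP/negPn/negP => ST.
have pick V : \sum_U (U == V)%:R *: Nf U = Nf V :> A.
  rewrite (bigD1 V) //= eqxx scale1r big1 ?addr0 // => U /negPf->.
  by rewrite scale0r.
have e : \sum_U ((U == S)%:R - (U == T)%:R) *: Nf U = 0 :> A.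
  under eq_bigr do rewrite scalerBl.
  rewrite sumrB; apply/eqP; rewrite subr_eq0; apply/eqP.
  exact: etrans (pick S) (etrans NST (esym (pick T))).
have /eqP := Nform_free e S.
by rewrite eqxx (negPf ST) subr0 oner_eq0.
Qed.

Lemma card_codom_Nform : size (undup (codom (fun S : {set 'I_n} => Nf S))) = (2 ^ n)%N.
Proof.
rewrite undup_id; first by rewrite size_codom -cardsT -powersetT card_powerset cardsT card_ord.
by apply/injectiveP/Nform_inj.
Qed.

End ExteriorBasis.

(** * Exterior invariants: spanning *)

Section Divisibility.
Variables (F : finFieldType) (n : nat).
Local Notation P := {mpoly F[n]}.
Local Notation A := (extalg (mpoly n F) n).
Local Notation frob := (@frob F n).
Local Notation below := (@below n).
Local Notation pidm := (pidm F n).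
Local Notation K b S := (kform frob (below b) S).
Implicit Types (g : 'M[F]_n) (f : P) (a : A) (s j : 'I_n) (S T U W : {set 'I_n}).

Lemma prod_lin_ygen_pidm m S : \prod_(j <- enum S) lin_ygen (pidm m) j =
  if S \subset below m then ybas P S else 0.
Proof.
have lin j : lin_ygen (pidm m) j = if (j < m)%N then ygen P j else 0.
  rewrite /lin_ygen /ylin (bigD1 j) //= mxE eqxx big1 ?addr0 => [|i ij].
    by case: ifP => _; rewrite ?scale1r // mpolyC0 scale0r.
  by rewrite mxE (negPf ij) mpolyC0 scale0r.
case: ifPn => [/subsetP Sm|/subsetPn[j jS]].
  rewrite -prod_ygen_enum; apply: eq_big_seq => j; rewrite mem_enum => /Sm.
  by rewrite inE lin => ->.
rewrite inE => jm; have /path.splitPr[s1 s2] : j \in enum S by rewrite mem_enum.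
by rewrite big_cat big_cons /= lin (negPf jm) /= mul0r mulr0.
Qed.

Lemma actA_pidmE m a U :
  actA (pidm m) a U = if U \subset below m then actP (pidm m) (a U) else 0.
Proof.
rewrite /actA sum_ffunE (bigD1 U) //= [X in _ + X]big1 => [|S SU].
  rewrite addr0 prod_lin_ygen_pidm ext_scaleE; case: ifP => _.
    by rewrite ybasE eqxx mulr1.
  by rewrite ffunE mulr0.
rewrite prod_lin_ygen_pidm ext_scaleE; case: ifP => _.
  by rewrite ybasE eq_sym (negPf SU) mulr0.
by rewrite ffunE mulr0.
Qed.

Lemma level_sub m a U : actA (pidm m) a = a -> a U != 0 -> U \subset below m.
Proof. by move=> am; rewrite -{1}am actA_pidmE; case: ifP; rewrite ?eqxx. Qed.

Lemma level_coef m a U : actA (pidm m) a = a -> actP (pidm m) (a U) = a U.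
Proof.
move=> am; have := actA_pidmE m a U; rewrite am; case: ifP => _ // ->.
by rewrite (rmorph0 (actP (pidm m))).
Qed.

Lemma actA_pidm_ybas m W : actA (pidm m) (ybas P W) = if W \subset below m then ybas P W else 0.
Proof. by rewrite (actA_ybas (pidm m)); apply: prod_lin_ygen_pidm. Qed.

Lemma actA_pidm_kform m (b : nat) S : (b <= m)%N ->
  actA (pidm m) (K b S) = if S \subset below m then K b S else 0.
Proof.
move=> bm; rewrite /kform actA_ctr actA_pidm_ybas subUset.
have -> : below b \subset below m.
  by apply/subsetP => j; rewrite !inE => jb; apply: leq_trans bm.
by rewrite andTb; case: ifP => // _; rewrite linear0.
Qed.

(** Coefficients on both sides of the fixed combination are compared by independence of the forms
    for one b; this serves for U_I and for [pidm] alike. *)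
Lemma kform_coef_fix g (b : nat) (c : {set 'I_n} -> P) : (b <= n)%N ->
    actA g (\sum_S c S *: K b S) = \sum_S c S *: K b S ->
    (forall S, c S != 0 -> actA g (K b S) = K b S) ->
  forall S, actP g (c S) = c S.
Proof.
move=> bn ga gK S; apply/eqP; rewrite -subr_eq0; apply/eqP.
apply: (@kform_free P n frob (below b) (fun S => actP g (c S) - c S) (topc_neq0 F bn)).
under eq_bigr do rewrite scalerBl.
rewrite sumrB; apply/eqP; rewrite subr_eq0; apply/eqP; rewrite -[RHS]ga actA_sum.
apply: eq_bigr => T _; have [->|cT] := eqVneq (c T) 0.
  by rewrite (rmorph0 (actP g)) !scale0r.
by rewrite (gK T cT).
Qed.

Lemma qcoef_level m (b : nat) a S : (b <= m)%N -> actA (pidm m) a = a ->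
  ~~ (S \subset below m) -> qcoef frob (below b) S a = 0.
Proof.
move=> bm am /subsetPn[j jS]; rewrite inE -leqNgt => mj; rewrite /qcoef.
set U := S :\: _; set E := S :&: _.
have em : actA (pidm m) (ctr frob E a) = ctr frob E a.
  by rewrite actA_ctr am.
apply: contraTeq (mj) => nz; rewrite -ltnNge.
have /subsetP/(_ j) := level_sub em nz; rewrite !inE jS andbT; apply.
by rewrite -leqNgt (leq_trans bm).
Qed.

Lemma cact_ctr g (E : {set 'I_n}) a :
  cact g (ctr frob E a) = ctr (fun e => actP g \o frob e) E (cact g a).
Proof.
rewrite /ctr; elim: (enum E) a => [|e l IH] a //.
by rewrite [LHS](IH (contr (frob e) a)) cact_contr.
Qed.

(** Matrix form of the fact that x_c := lam.x kills x_c - lam.x. *)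
Lemma colmx_ker (c : 'I_n) (lam : {ffun {i : 'I_n | (i < c)%N} -> F}) i :
  \sum_k colmx c (lvec lam) i k * ((k == c)%:R - lvec lam k) = 0.
Proof.
have lc : lvec lam c = 0 by apply/eqP/negPn/negP => /lvec_ge; rewrite ltnn.
rewrite (bigD1 c) //= eqxx lc subr0 mulr1 mxE eqxx.
have [->|ic] := eqVneq i c.
  by rewrite lc add0r big1 // => k kc; rewrite mxE (negPf kc) eq_sym (negPf kc) mul0r.
rewrite (bigD1 i) //= big1 => [|k /andP[kc ki]].
  by rewrite addr0 mxE (negPf ic) eqxx mul1r sub0r addrN.
by rewrite mxE (negPf kc) eq_sym (negPf ki) mul0r.
Qed.

(** By [topc_dvd] it suffices to reduce the coefficients modulo x_c - lam.x. There y_c - lam.y pairs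
    to 0 with all Frobenius vectors, so it annihilates the contractions too, and its coefficient 1
    at c < b makes their coefficients at sets avoiding [below b] vanish. *)
Lemma qcoef_dvd (b : nat) a : (b <= n)%N ->
    (forall (c : 'I_n) (lam : {ffun {i : 'I_n | (i < c)%N} -> F}), (c < b)%N ->
       ylin (fun i => ((i == c)%:R - lvec lam i)%:MP : P) * cact (colmx c (lvec lam)) a = 0) ->
  forall S, exists h, qcoef frob (below b) S a = topc frob (below b) * h.
Proof.
move=> bn aC S; apply: (topc_dvd bn) => c lam cb.
set E := colmx c (lvec lam); rewrite /qcoef -cactE cact_ctr.
set nu := fun i : 'I_n => ((i == c)%:R - lvec lam i)%:MP : P.
have lc : lvec lam c = 0 by apply/eqP/negPn/negP => /lvec_ge; rewrite ltnn.
apply: (@ylin_mul_coef0 P n nu c) => [|||].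
- by rewrite /nu eqxx lc subr0.
- by rewrite !inE cb.
- move=> i; rewrite !inE -leqNgt => /andP[bi _]; rewrite /nu.
  have ci : (c < i)%N by apply: leq_trans bi.
  have -> : lvec lam i = 0.
    by apply/eqP/negPn/negP => /lvec_ge; rewrite ltnNge (ltnW ci).
  by rewrite subr0 -val_eqE /= gtn_eqF // mpolyC0.
apply: contrs_ylin_eq0 (aC c lam cb) => e /=.
(* [M] sends x_c to x_c - lam.x, so [frob e c] becomes the q^e-th power of that form, which E
   kills. *)
pose M := colmx c (fun i => (i == c)%:R - lvec lam i).
have : actP (E *m M) (frob e c) = 0.
  rewrite actP_frob big1 // => i _; rewrite (_ : (E *m M) i c = 0) ?mpolyC0 ?mul0r //.
  rewrite mxE -[RHS](colmx_ker lam i); apply: eq_bigr => k _.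
  by rewrite [M k c]mxE eqxx.
rewrite -actP_comp actP_frob (rmorph_sum (actP E)) => e0; rewrite -[RHS]e0.
apply: eq_bigr => i _; rewrite [RHS](rmorphM (actP E)); congr (_ * _).
by rewrite [RHS](actP_C E) mxE eqxx.
Qed.

End Divisibility.

Section Spanning.
Variables (F : finFieldType) (n : nat) (I : seq nat) (sumI : sumn I = n).
Local Notation P := {mpoly F[n]}.
Local Notation A := (extalg (mpoly n F) n).
Local Notation t := (tau I).
Local Notation pidm := (pidm F n).
Local Notation vp s := (vprod F (t s) s).
Implicit Types (g : 'M[F]_n) (f : P) (a : A) (s j : 'I_n) (S T U W : {set 'I_n}).

Lemma cact0 g : cact g 0 = 0.
Proof. by apply/ffunP => U; rewrite cactE !ffunE (rmorph0 (actP g)). Qed.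

Lemma cact_ylin g (c : 'I_n -> F) :
  cact g (ylin (fun i => (c i)%:MP : P)) = ylin (fun i => (c i)%:MP : P).
Proof.
apply/ffunP => U; rewrite cactE /ylin sum_ffunE rmorph_sum; apply: eq_bigr => i _ /=.
rewrite ext_scaleE rmorphM /= actP_C ybasE.
by case: (U == [set i]); rewrite ?(rmorph1 (actP g)) ?(rmorph0 (actP g)).
Qed.

Lemma cact_ylinM g (c : 'I_n -> F) a :
  cact g (ylin (fun i => (c i)%:MP : P) * a) = ylin (fun i => (c i)%:MP : P) * cact g a.
Proof. by rewrite cact_mul cact_ylin. Qed.

Lemma cactN g a : cact g (- a) = - cact g a.
Proof. by apply/ffunP => U; rewrite cactE !ext_oppE cactE (rmorphN (actP g)). Qed.

Lemma actA_contr_delta g s a : (forall j, g s j = (s == j)%:R) ->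
  actA g (contr (delta s) a) = contr (delta s) (actA g a).
Proof.
move=> gs; apply: actA_contr => j; rewrite (bigD1 s) //= /delta eqxx mulr1 gs.
rewrite big1 ?addr0 => [|i /negPf->]; last by rewrite mulr0.
by rewrite eq_sym; case: (s == j); rewrite ?(rmorph1 (actP g)) ?(rmorph0 (actP g)).
Qed.

(* The substitution x_s := mu.x, y_s := mu.y, with the later variables set to 0. *)
Definition transl s (mu : {ffun {c : 'I_n | (c < t s)%N} -> F}) : 'M[F]_n :=
  pidm s *m tmat s (lvec mu).

Lemma transl_col s (mu : {ffun {c : 'I_n | (c < t s)%N} -> F}) i :
  transl mu i s = lvec mu i.
Proof.
rewrite /transl pidm_mulE mxE eqxx /=; have [->|/lvec_ge its] := eqVneq (lvec mu i) 0.
  by case: (i =P s) => [->|]; rewrite /= ?ltnn ?mul0r ?mulr0.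
have lt_is := leq_trans its (tau_le I s).
by rewrite lt_is mul1r ifT // -val_eqE /= ltn_eqF.
Qed.

Lemma transl_neq s (mu : {ffun {c : 'I_n | (c < t s)%N} -> F}) i j : j != s ->
  transl mu i j = (i < s)%:R * (i == j)%:R.
Proof. by move=> js; rewrite /transl pidm_mulE mxE (negPf js). Qed.

Lemma actA_transl_inv s (mu : {ffun {c : 'I_n | (c < t s)%N} -> F}) a : a \in invA I ->
  actA (transl mu) a = actA (pidm s) a.
Proof.
move=> /invAP aU; rewrite -(actA_comp (pidm s)).
by rewrite (aU _ (tmat_UI sumI mu)).
Qed.

Lemma actA_transl_delta s (mu : {ffun {c : 'I_n | (c < t s)%N} -> F}) a : a \in invA I ->
  actA (transl mu) (contr (delta s) a) = actA (pidm s) (contr (delta s) a).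
Proof.
move=> /invAP aU; rewrite -(actA_comp (pidm s)) actA_contr_delta.
  by rewrite (aU _ (tmat_UI sumI mu)).
by move=> j; rewrite mxE eqxx andbF.
Qed.

Lemma actA_transl_cact s (mu : {ffun {c : 'I_n | (c < t s)%N} -> F}) a :
    actA (pidm s.+1) a = a -> (forall U, s \in U -> a U = 0) ->
  actA (transl mu) a = cact (transl mu) a.
Proof.
move=> am as0; apply: actA_cact => U j aU jU i.
have sU : s \notin U by apply: contraNN aU => /as0->.
have js : j != s by apply: contraNneq sU => <-.
have := level_sub am aU; move=> /subsetP/(_ j jU); rewrite inE ltnS leq_eqVlt.
rewrite val_eqE (negPf js) /= => lt_js; rewrite transl_neq //.
by case: (i =P j) => [->|_]; rewrite ?lt_js ?mulr1 ?mulr0.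
Qed.

Lemma pidm_delta (m : nat) s a : (s < m)%N ->
  actA (pidm m) (contr (delta s) a) = contr (delta s) (actA (pidm m) a).
Proof.
move=> sm; apply: actA_contr_delta => j; rewrite mxE.
by case: (s =P j) => [<-|//]; rewrite sm.
Qed.

Lemma ygen_level (m : nat) s : (s < m)%N -> actA (pidm m) (ygen P s) = ygen P s.
Proof.
move=> sm; rewrite /ygen actA_pidm_ybas ifT //.
by apply/subsetP => j; rewrite !inE => /eqP->.
Qed.

Lemma rest_level s a : actA (pidm s.+1) a = a ->
  actA (pidm s.+1) (a - ygen P s * contr (delta s) a) = a - ygen P s * contr (delta s) a.
Proof.
move=> am; rewrite (raddfB (actA (pidm s.+1))) /= (actA_mul _ (ygen P s)).
have dm : actA (pidm s.+1) (contr (delta s) a) = contr (delta s) a.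
  exact: (etrans (pidm_delta a (ltnSn s)) (f_equal (contr (delta s)) am)).
exact: (f_equal2 (fun x y : A => x - y) am
  (f_equal2 (fun x y : A => x * y) (ygen_level (ltnSn s)) dm)).
Qed.

Lemma actA_transl_rest s (mu : {ffun {c : 'I_n | (c < t s)%N} -> F}) a :
    a \in invA I -> actA (pidm s) a = 0 ->
  actA (transl mu) (a - ygen P s * contr (delta s) a) =
  - (ylin (fun i => (lvec mu i)%:MP : P) * actA (pidm s) (contr (delta s) a)).
Proof.
move=> aU a0; rewrite (raddfB (actA (transl mu))) /= (actA_mul _ (ygen P s)).
rewrite (actA_transl_inv mu aU) a0 sub0r (actA_transl_delta mu aU) (actA_ygen _ s).
have -> : lin_ygen (transl mu) s = ylin (fun i => (lvec mu i)%:MP : P).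
  by apply: eq_bigr => i _; rewrite transl_col.
exact: erefl.
Qed.

(* Take mu = e_c - lam: modulo x_c - lam.x, the form mu.x is 0. *)
Lemma translation_condition s a (c : 'I_n) (lam : {ffun {i : 'I_n | (i < c)%N} -> F}) :
    a \in invA I -> actA (pidm s.+1) a = a -> actA (pidm s) a = 0 -> (c < t s)%N ->
  ylin (fun i => ((i == c)%:R - lvec lam i)%:MP : P) *
    cact (colmx c (lvec lam)) (actA (pidm s) (contr (delta s) a)) = 0.
Proof.
move=> aU am a0 cs; set E := colmx c (lvec lam).
set alpha := actA (pidm s) _; pose r := a - ygen P s * contr (delta s) a.
have rm : actA (pidm s.+1) r = r by apply: rest_level.
have r0 U : s \in U -> r U = 0 by move=> sU; rewrite /r subr_ygen_contr_delta sU.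
pose mu : {ffun {i : 'I_n | (i < t s)%N} -> F} :=
  [ffun i => (val i == c)%:R - lvec lam (val i)].
have muE i : lvec mu i = (i == c)%:R - lvec lam i.
  rewrite {1}/lvec; case: insubP => [u _ <-|its]; first by rewrite ffunE.
  have lt_ci : (c < i)%N by rewrite (leq_trans cs) // leqNgt.
  have -> : lvec lam i = 0.
    by apply/eqP/negPn/negP => /lvec_ge; rewrite ltnNge (ltnW lt_ci).
  by rewrite subr0 -val_eqE /= gtn_eqF.
have zero_lvec i : lvec (0 : {ffun {i : 'I_n | (i < t s)%N} -> F}) i = 0.
  by rewrite /lvec; case: insubP => // u _ _; rewrite ffunE.
(* Consequently r has, modulo x_c - lam.x, the same value at [mu] as at 0, where it vanishes. *)
have EG : E *m transl mu = E *m transl (0 : {ffun {i : 'I_n | (i < t s)%N} -> F}).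
  apply/matrixP => i j; rewrite !mxE; have [->|js] := eqVneq j s.
    rewrite [RHS]big1 => [|k _]; last by rewrite transl_col zero_lvec mulr0.
    rewrite -[RHS](colmx_ker lam i); apply: eq_bigr => k _.
    by rewrite transl_col muE.
  by apply: eq_bigr => k _; rewrite !transl_neq.
have c0 : cact (transl (0 : {ffun {i : 'I_n | (i < t s)%N} -> F})) r = 0.
  rewrite -(actA_transl_cact _ rm r0) (actA_transl_rest _ aU a0) /ylin big1 ?mul0r ?oppr0 //.
  by move=> i _; rewrite zero_lvec mpolyC0 scale0r.
have c1 : cact (transl mu) r = - (ylin (fun i => (lvec mu i)%:MP : P) * alpha).
  by rewrite -(actA_transl_cact _ rm r0) (actA_transl_rest _ aU a0).
have e : cact E (cact (transl mu) r) = 0 by rewrite cact_comp EG -cact_comp c0 cact0.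
move: e; rewrite c1 cactN cact_ylinM => /eqP; rewrite oppr_eq0 => /eqP e.
have nuE : ylin (fun i => ((i == c)%:R - lvec lam i)%:MP : P) =
           ylin (fun i => (lvec mu i)%:MP : P).
  by apply: eq_bigr => i _; rewrite muE.
by rewrite nuE; exact: e.
Qed.

(** With alpha = 0, both parts of a = r + y_s d vanish at every x_s = mu.x, and each coefficient of
    a is one of r or, up to sign, one of d. *)
Lemma coef_vprod_dvd s a : a \in invA I -> actA (pidm s.+1) a = a ->
    actA (pidm s) a = 0 -> actA (pidm s) (contr (delta s) a) = 0 ->
  forall U, exists h, a U = vp s * h.
Proof.
move=> aU am a0 a1 U; apply: vprod_dvd => mu.
pose r := a - ygen P s * contr (delta s) a.
have rm : actA (pidm s.+1) r = r by apply: rest_level.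
have r0 (V : {set 'I_n}) : s \in V -> r V = 0 by move=> sV; rewrite /r subr_ygen_contr_delta sV.
have dm : actA (pidm s.+1) (contr (delta s) a) = contr (delta s) a.
  by rewrite pidm_delta // am.
have d0 (V : {set 'I_n}) : s \in V -> contr (delta s) a V = 0 by move=> sV; rewrite contr_delta sV.
have cr : cact (transl mu) r = 0.
  by rewrite -(actA_transl_cact _ rm r0) (actA_transl_rest _ aU a0) a1 mulr0 oppr0.
have cd : cact (transl mu) (contr (delta s) a) = 0.
  by rewrite -(actA_transl_cact _ dm d0) (actA_transl_delta _ aU) a1.
rewrite horner_phi_lform -(level_coef U am) actP_comp -pidm_tmat -/(transl mu).
case: (boolP (s \in U)) => sU.
  rewrite (coef_contr_delta a sU) (rmorphM (actP (transl mu))) /=.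
  have := congr1 (fun x : A => x (U :\ s)) cd; rewrite cactE [RHS]ffunE => ->.
  by rewrite mulr0.
have := congr1 (fun x : A => x U) cr.
by rewrite cactE [RHS]ffunE /r subr_ygen_contr_delta (negPf sU).
Qed.

End Spanning.

(** * Induction on the number of variables and on the degree in the last one *)

Section SpanningInduction.
Variables (F : finFieldType) (n : nat) (I : seq nat) (sumI : sumn I = n).
Local Notation P := {mpoly F[n]}.
Local Notation A := (extalg (mpoly n F) n).
Local Notation q := #|F|.
Local Notation frob := (@frob F n).
Local Notation below := (@below n).
Local Notation t := (tau I).
Local Notation pidm := (pidm F n).
Local Notation Nf S := (Nform F q (tau_set I S) S).
Local Notation K b S := (kform frob (below b) S).
Local Notation vp s := (vprod F (t s) s).
Implicit Types (g : 'M[F]_n) (f : P) (a : A) (s j : 'I_n) (S T U W : {set 'I_n}).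

Lemma tau_n s : (t s <= n)%N.
Proof. by rewrite (leq_trans (tau_le I s)) // ltnW. Qed.

Lemma actA_sum_fix (J : finType) g (c : J -> P) (u : J -> A) :
    (forall x, c x = 0 \/ actP g (c x) = c x /\ actA g (u x) = u x) ->
  actA g (\sum_x c x *: u x) = \sum_x c x *: u x.
Proof.
move=> cu; rewrite actA_sum; apply: eq_bigr => x _; case: (cu x) => [->|[cx ux]].
  by rewrite (rmorph0 (actP g)) !scale0r.
exact: (f_equal2 (fun (f : P) (b : A) => f *: b) cx ux).
Qed.

(** Past [pidm s], g may be replaced by [colmod g s], whose row s is that of the identity, so that
    it commutes with the contraction along y_s. *)
Lemma contr_delta_UI g s a : g \in UI F n I -> a \in invA I ->
  actA g (actA (pidm s) (contr (delta s) a)) = actA (pidm s) (contr (delta s) a).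
Proof.
move=> gU /invAP aU; rewrite (actA_comp g (pidm s)) -(pidm_colmod sumI s gU).
rewrite -(actA_comp (pidm s)) actA_contr_delta.
  by rewrite (aU _ (colmod_UI sumI s gU)).
move=> j; rewrite mxE; case: ifP => // lt_js; apply: (UIP sumI _ gU).
by rewrite -leqNgt (leq_trans (tau_le I j)) // ltnW.
Qed.

Lemma residue_decomp s a : a \in invA I -> actA (pidm s.+1) a = a -> actA (pidm s) a = 0 ->
  exists c : {set 'I_n} -> P,
    [/\ actA (pidm s) (contr (delta s) a) = \sum_S c S *: K (t s) S,
        forall S, c S \in invP I,
        forall S, actP (pidm s) (c S) = c S &
        forall S, ~~ (S \subset below s) -> c S = 0].
Proof.
move=> aU am a0; set alpha := actA _ (contr _ _).
have am' : actA (pidm s) alpha = alpha.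
  by rewrite /alpha (actA_comp (pidm s) (pidm s)) pidm_pidm.
have dvd S : exists h, qcoef frob (below (t s)) S alpha = topc frob (below (t s)) * h.
  apply: (qcoef_dvd (tau_n s)) => c lam cs.
  exact: (translation_condition sumI lam aU am a0 cs).
have [c cE] := kform_decomp (topc_neq0 F (tau_n s)) dvd.
have c_out S : ~~ (S \subset below s) -> c S = 0.
  move=> Ss; have [k] := qcoef_kform_sum frob (below (t s)) c S.
  rewrite -cE (qcoef_level (tau_le I s) am' Ss) => /esym/eqP.
  by rewrite !mulf_eq0 signr_eq0 (negPf (topc_neq0 F (tau_n s))) !orbF => /eqP.
have c_in S : c S != 0 -> S \subset below s.
  by apply: contraNT => /c_out->.
exists c; split; [exact: cE | move=> S | move=> S | exact: c_out].
  apply/invPP => g gU; apply: (@kform_coef_fix F n g (t s) c (tau_n s)) => [|T].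
    by rewrite -cE; apply: contr_delta_UI.
  move=> /c_in/subsetP Ts; apply: (UI_kform sumI gU) => j /Ts; rewrite inE => js.
  exact: tau_mono (ltnW js).
apply: (@kform_coef_fix F n (pidm s) (t s) c (tau_n s)) => [|T /c_in Ts].
  by rewrite -cE; exact: am'.
by rewrite (actA_pidm_kform F T (tau_le I s)) Ts.
Qed.

Lemma below_max s S : S \subset below s -> forall j, j \in s |: S -> (j <= s)%N.
Proof.
by move=> /subsetP Ss j; rewrite !inE => /orP[/eqP->//|/Ss]; rewrite inE => /ltnW.
Qed.

Lemma Nform_setU1 s S : S \subset below s ->
  exists k, Nf (s |: S) = (-1) ^+ k *: K (t s) (s |: S).
Proof. by move=> Ss; apply: Nform_max (setU11 s S) (below_max Ss). Qed.

Lemma contr_delta_Nform s S : S \subset below s ->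
  exists k, contr (delta s) (Nf (s |: S)) = (-1) ^+ k *: K (t s) S.
Proof.
move=> Ss; have [k kE] := Nform_setU1 Ss.
have [k' k'E] := contr_delta_kform_in F (tau_le I s) (setU11 s S).
have sS : s \notin S by apply/negP => /(subsetP Ss); rewrite inE ltnn.
rewrite setU1K // in k'E; exists (k + k')%N; rewrite exprD.
by have := contr_scale 1 kE k'E; rewrite scale1r mul1r.
Qed.

Lemma actA_pidm_Nform (m : nat) s S : S \subset below s -> (s <= m)%N ->
  actA (pidm m) (Nf (s |: S)) = if (s < m)%N then Nf (s |: S) else 0.
Proof.
move=> Ss sm; have [k ->] := Nform_setU1 Ss.
rewrite (actA_scale (pidm m)) (actA_pidm_kform F _ (leq_trans (tau_le I s) sm)).
rewrite subUset sub1set inE (subset_trans Ss) ?andbT; last first.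
  by apply/subsetP => j; rewrite !inE => js; apply: leq_trans sm.
rewrite (rmorphXn (actP (pidm m))) (rmorphN1 (actP (pidm m))).
by case: ifP => _ //; rewrite scaler0.
Qed.

Lemma dbound_Nform s S : S \subset below s -> dbound s (q ^ t s) (Nf (s |: S)).
Proof.
move=> Ss U; have [k ->] := Nform_setU1 Ss.
rewrite ext_scaleE size_phi_signM; apply: dbound_ctr (subsetDl _ _) _ U.
by apply: dbound_ybas; rewrite expn_gt0 (ltnW (q_gt1 F)).
Qed.

(** The decomposition of alpha is lifted by replacing each form of S by the form of S + s, signs
    going into the coefficients. These are free of x_s, which keeps the degree of w in x_s below
    that of v_s. *)
Lemma correction s a : a \in invA I -> actA (pidm s.+1) a = a -> actA (pidm s) a = 0 ->
  exists w : A,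
    [/\ Nspan I w, actA (pidm s.+1) w = w, actA (pidm s) w = 0,
        contr (delta s) w = actA (pidm s) (contr (delta s) a) &
        forall U, (size (phi s (w U)) <= q ^ t s)%N].
Proof.
move=> aU am a0; have [c [-> cU cm c_out]] := residue_decomp aU am a0.
have /fin_all_exists[k kE] : forall S, exists k, S \subset below s ->
    contr (delta s) (Nf (s |: S)) = (-1) ^+ k *: K (t s) S.
  move=> S; case: (boolP (S \subset below s)) => Ss; last by exists 0%N.
  by have [k kE] := contr_delta_Nform Ss; exists k.
pose d S := (-1) ^+ k S * c S.
have dU S : d S \in invP I by apply: invPM; [apply: invP_N1X | apply: cU].
have dm S : actP (pidm s) (d S) = d S.
  by rewrite /d (rmorphM (actP (pidm s))) (rmorphXn (actP _)) (rmorphN1 (actP _)) /= cm.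
have d_out S : ~~ (S \subset below s) -> d S = 0 by move=> Ss; rewrite /d c_out // mulr0.
exists (\sum_S d S *: Nf (s |: S)); split.
- by apply: Nspan_sum => S; apply: NspanZ (dU S) (Nspan_N _ _ _).
- apply: actA_sum_fix => S; case: (boolP (S \subset below s)) => Ss; last by left; apply: d_out.
  right; split; last by rewrite (actA_pidm_Nform Ss (leqnSn s)) ltnSn.
  by rewrite -{1}dm (actP_comp (pidm s.+1)) pidm_pidm // dm.
- rewrite actA_sum big1 // => S _; case: (boolP (S \subset below s)) => Ss.
    by rewrite (actA_pidm_Nform Ss (leqnn s)) ltnn scaler0.
  by rewrite d_out // (rmorph0 (actP _)) scale0r.
- rewrite linear_sum; apply: eq_bigr => S _; rewrite [LHS]contrZ.
  case: (boolP (S \subset below s)) => Ss; last by rewrite d_out // c_out // !scale0r.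
  by rewrite kE // scalerA /d mulrAC -expr2 sqrr_sign mul1r.
move=> U; rewrite sum_ffunE; apply: size_phi_sum => S _; rewrite ext_scaleE.
case: (boolP (S \subset below s)) => Ss; last first.
  by rewrite d_out // mul0r (rmorph0 (phi s)) size_poly0.
rewrite phiM (@phi_pidm F n s _ (dm S)) mul_polyC.
apply: leq_trans (size_scale_leq _ _) _; apply: leq_trans (dbound_Nform Ss U) _.
by case: ifP => // _; rewrite expn_gt0 (ltnW (q_gt1 F)).
Qed.

Lemma invA_coef_quot s a (b : A) : a = vp s *: b -> a \in invA I ->
  actA (pidm s.+1) a = a -> b \in invA I /\ actA (pidm s.+1) b = b.
Proof.
move=> ab /invAP aU am; have v0 : vp s != 0 by apply/vprod_neq0/tau_le.
have cancel (x y : A) : vp s *: x = vp s *: y -> x = y.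
  move=> xy; apply/ffunP => U; apply: (mulfI v0).
  by have := congr1 (fun z : A => z U) xy; rewrite !ext_scaleE.
split.
  apply/invAP => g gU; apply: cancel; rewrite -ab -[RHS](aU g gU) ab.
  by rewrite (actA_scale g) (UI_vprod sumI s gU).
have vE : actP (pidm s.+1) (vp s) = vp s.
  by rewrite (actP_pidm_vprod F s.+1 (tau_le I s)) ltnSn.
by apply: cancel; rewrite -ab -[RHS]am ab (actA_scale (pidm s.+1)) vE.
Qed.

Lemma actA_pidm_residue m a : actA (pidm m) (a - actA (pidm m) a) = 0.
Proof.
rewrite (raddfB (actA (pidm m))) /= (actA_comp (pidm m) (pidm m) a).
by rewrite (pidm_pidm F n (leqnn m)) subrr.
Qed.

Lemma invA_Nspan_level m a : (m <= n)%N -> a \in invA I -> actA (pidm m) a = a ->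
  Nspan I a.
Proof.
elim: m a => [|m IHm] a mn aU am.
  have -> : a = a set0 *: Nf (set0 : {set 'I_n}).
    apply/ffunP => U; rewrite ext_scaleE Nform0 ext_1E.
    have [->|U0] := eqVneq U set0; first by rewrite mulr1.
    rewrite mulr0; apply: contraNeq U0 => /(level_sub am) Ub.
    by rewrite -subset0; apply: subset_trans Ub _; apply/subsetP => j; rewrite !inE.
  apply: NspanZ (Nspan_N _ _ _); apply/invPP => g gU.
  by rewrite -actA_coef0; move/invAP: aU => ->.
pose s := Ordinal mn.
have [d] : exists d, forall U : {set 'I_n}, (size (phi s (a U)) <= d)%N.
  exists (\max_(U : {set 'I_n}) size (phi s (a U)))%N => U.
  exact: (leq_bigmax (F := fun U => size (phi s (a U)))).
elim: d a aU am => [|d IHd] a aU am ad.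
  have -> : a = 0.
    apply/ffunP => U; rewrite [RHS]ffunE; apply: (@phi_inj F n s).
    by rewrite (rmorph0 (phi s)); apply/eqP; rewrite -size_poly_eq0 -leqn0.
  exact: Nspan0.
pose a0 := actA (pidm m) a; pose f := a - a0.
have a0U : a0 \in invA I by apply: invA_pidm.
have a0m : actA (pidm m) a0 = a0 by rewrite /a0 (actA_comp (pidm m) (pidm m)) pidm_pidm.
have a0m1 : actA (pidm m.+1) a0 = a0.
  exact: (etrans (actA_comp (pidm m.+1) (pidm m) a)
    (f_equal (fun g => actA g a) (@pidm_pidm F n m m.+1 (leqnSn m)))).
have fU : f \in invA I by exact: (invAB aU a0U).
have fm : actA (pidm m.+1) f = f.
  by rewrite (raddfB (actA (pidm m.+1))); apply: (f_equal2 (fun x y : A => x - y) am a0m1).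
have f0 : actA (pidm m) f = 0.
  rewrite (raddfB (actA (pidm m))) /= -/a0.
  exact: (etrans (f_equal (fun x : A => a0 - x) a0m) (subrr a0)).
have [w [wN wm w0 wd w_size]] := @correction s f fU fm f0.
have wU := Nspan_inv sumI wN.
pose a' := f - w.
have a'U : a' \in invA I by exact: (invAB fU wU).
have a'm : actA (pidm s.+1) a' = a'.
  by rewrite (raddfB (actA (pidm s.+1))); apply: (f_equal2 (fun x y : A => x - y) fm wm).
have a'0 : actA (pidm s) a' = 0.
  rewrite (raddfB (actA (pidm s))).
  exact: (etrans (f_equal2 (fun x y : A => x - y) f0 w0) (subrr 0)).
(* The correction removes from the contraction of [f] its value at x_s = y_s = 0, and [pidm s] is
   idempotent. *)
have a'd : actA (pidm s) (contr (delta s) a') = 0.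
  have -> : contr (delta s) a' = contr (delta s) f - actA (pidm s) (contr (delta s) f).
    exact: (etrans (contrB (delta s) f w) (f_equal (fun x : A => contr (delta s) f - x) wd)).
  exact: actA_pidm_residue.
have /fin_all_exists[h hE] := coef_vprod_dvd sumI a'U a'm a'0 a'd.
pose b : A := [ffun U : {set 'I_n} => h U].
have a'b : a' = vp s *: b by apply/ffunP => U; rewrite ext_scaleE [b U]ffunE hE.
have [bU bm] := invA_coef_quot a'b a'U a'm.
have bN : Nspan I b.
  apply: (IHd b bU bm) => U; rewrite [b U]ffunE.
  (* In a' = a - a0 - w, the first two terms have size at most d+1 and w has size at most
     q^tau(s). *)
  apply: (@size_phi_quot F n (t s) s (a' U) (h U) d (tau_le I s) (hE U)).
  have sa0 : (size (phi s (a0 U)) <= d.+1)%N.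
    rewrite (@phi_pidm F n s _ (level_coef U a0m)).
    exact: leq_trans (size_polyC_leq1 _) _.
  rewrite /a' /f !ext_addE !ext_oppE !phiB.
  apply: leq_trans (size_polyD _ _) _; rewrite size_polyN geq_max leq_max.
  rewrite [X in _ && X]leq_max (w_size U) orbT andbT.
  apply/orP; left; apply: leq_trans (size_polyD _ _) _.
  by rewrite size_polyN geq_max; apply/andP; split; [exact: ad | exact: sa0].
have -> : a = a0 + (w + vp s *: b).
  by rewrite -a'b /a' [w + _]addrC subrK /f addrC subrK.
apply: NspanD; first exact: IHm a0 (ltnW mn) a0U a0m.
apply: NspanD wN _; apply: NspanZ bN; apply/invPP => g gU.
exact: (UI_vprod sumI s gU).
Qed.

Lemma invA_Nspan a : a \in invA I -> Nspan I a.
Proof.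
move=> aU; apply: (invA_Nspan_level (leqnn n) aU).
apply/ffunP => U; rewrite actA_pidmE actP_pidm_full ifT //.
by apply/subsetP => j _; rewrite inE.
Qed.

End SpanningInduction.

Theorem theorem4p13 (p r n : nat) (F : finFieldType) (I : seq nat)
    (p_prime : prime p) (r_gt0 : (0 < r)%N) (cardF : #|F| = (p ^ r)%N)
    (compI : composition I n) :
  let gens := [tuple if (s < head 0 I)%N then 'X_s else vpoly F I s | s < n] in
  let N (S : {set 'I_n}) := Nform F (p ^ r) (tau_set I S) S in
  (* (1) *)
  [/\ forall f : {mpoly F[n]},
        f \in invP I <-> exists h : {mpoly F[n]}, f = h \mPo gens
    & forall h : {mpoly F[n]}, h \mPo gens = 0 -> h = 0] /\
  (* (2) *)
  [/\ forall a : extalg (mpoly n F) n,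
        a \in invA I <->
        exists2 c : {set 'I_n} -> {mpoly F[n]},
          (forall S, c S \in invP I) & a = \sum_S c S *: N S,
      forall c : {set 'I_n} -> {mpoly F[n]},
        (forall S, c S \in invP I) -> \sum_S c S *: N S = 0 ->
        forall S, c S = 0
    & size (undup (codom N)) = (2 ^ n)%N].
Proof.
move=> gens N; have sumI : sumn I = n := compI.2.
(* In the first block tau is 0 and the product has the single factor x_s, so all generators have one
   form. *)
have gensE s : tnth gens s = vprod F (tau I s) s.
  rewrite tnth_mktuple; case: ifP => [sI|//].
  have rI : reshape_index I s = 0%N.
    by have := @flatten_indexKl I 0 s; rewrite nth0 /flatten_index take0 => ->.
  by rewrite /tau rI take0 vprod0.
have NE S : N S = Nform F #|F| (tau_set I S) S by rewrite /N -cardF.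
have NsE (c : {set 'I_n} -> {mpoly F[n]}) :
    \sum_S c S *: N S = \sum_S c S *: Nform F #|F| (tau_set I S) S.
  by apply: eq_bigr => S _; rewrite NE.
split; first split=> [f|h].
- split=> [fU|[h ->]]; last exact: (comp_gens_inv sumI gensE).
  exact: (invP_gens_level sumI gensE (leqnn n) fU (actP_pidm_full f)).
- exact: (comp_gens_eq0 gensE).
split=> [a|c cU|].
- split=> [aU|[c cU ->]].
    have [c cU aE] := invA_Nspan sumI aU.
    exists c; first exact: cU.
    exact: (etrans aE (esym (NsE c))).
  apply: (Nspan_inv sumI); exists c; first exact: cU.
  exact: NsE.
- by move=> c0; apply: (@Nform_free F n I); apply: (etrans (esym (NsE c)) c0).
rewrite (eq_codom NE); exact: card_codom_Nform.
Qed.
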